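(* Let $D\subset\mathbb{R}^n$ be a measurable set with $0<\mu(D)<\infty$, where $\mu$ is Lebesgue measure, let $T$ be a finite set, and let $f:D\to T$ be a measurable function. For any $\epsilon>0$, the graph $\mathrm{gr}(f)\subset D\times T$ can be equipped with a linear logifold structure that has a chart which is entire up to measure $\epsilon$.
   Context: The graph $\mathrm{gr}(f)=\{(x,f(x)):x\in D\}\subset D\times T$ carries the subspace topology ($T$ discrete) and the push-forward of the Lebesgue measure under $D\to\mathrm{gr}(f)$, $x\mapsto(x,f(x))$. Hausdorff measure. For $p\ge 0$, $\delta>0$, $E\subset\mathbb{R}^n$, put $H^p_\delta(E)=\inf \sum_{U}\mathrm{Diam}(U)^p$, the infimum over covers of $E$ by sets $U$ with $\mathrm{Diam}(U)<\delta$, and $H^p(E)=\lim_{\delta\to0}H^p_\delta(E)$. Linear logifold. A linear logifold is a pair $(X,\mathcal{U})$, where $X$ is a topological space equipped with a $\sigma$-algebra and a measure $\mu$, and $\mathcal{U}$ is a collection of pairs $(U_i,\phi_i)$ (called charts) where $U_i\subset X$ are subsets with $\mu(U_i)>0$ and $\mu(X-\bigcup_i U_i)=0$, and $\phi_i$ are measure-preserving homeomorphisms between $U_i$ and the graphs of linear logical functions $f_i:D_i\to T_i$ (with the measure induced from the $p_i$-dimensional Hausdorff measure on $D_i$), where $D_i\subset\mathbb{R}^{n_i}$ are $H^{p_i}$-measurable subsets in certain dimension $p_i$ and $T_i$ are discrete sets. A linear logifold structure on a given space $X$ is such a collection $\mathcal{U}$. A chart $(U,\phi)$ is entire up to measure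 $\epsilon$ if $\mu(X-U)<\epsilon$. Linear logical functions. For an affine linear function $l=(l_1,\ldots,l_k)$ on $\mathbb{R}^n$, the chambers of $l$ are the regions into which $\mathbb{R}^n$ is subdivided by the hyperplanes $\{l_i=0\}$; they are defined to contain some of their boundary strata in such a way that they are disjoint and their union is $\mathbb{R}^n$ (concretely: the nonempty sets obtained by imposing, for each $i$, either $l_i\ge 0$ or $l_i<0$). Let $D\subset\mathbb{R}^n$ and let $T$ be a finite set. A linear logical graph $(G,L)$ consists of a finite directed graph $G$ (parallel arrows allowed) with no oriented cycle, with exactly one source vertex (vertex with no incoming arrow) and exactly $|T|$ target vertices (vertices with no outgoing arrow), identified with the elements of $T$, together with a collection $L=\{l_v\}$ of affine linear functions on $\mathbb{R}^n$, one for each vertex $v$ having more than one outgoing arrow, such that the chambers of $l_v$ are in one-to-one correspondence with the outgoing arrows of $v$. It determines a function $f_{G,L}: D\to T$: given $x\in D$, start at the source vertex; at a vertex with exactly one outgoing arrow follow that arrow; at a vertex $v$ with more than one outgoing arrow follow the arrow corresponding to the chamber of $l_v$ containing $x$; this stops at a target vertex, and $f_{G,L}(x)\in T$ is the element associated to it. A function $D\to T$ is a linear logical function if it equals $f_{G,L}$ for some linear logical graph $(G,L)$. *)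

(* Defs.v *)
From HB Require Import structures.
From mathcomp Require Import all_boot all_order all_algebra.
From mathcomp Require Import all_classical all_reals all_analysis.
Import Order.TTheory GRing.Theory Num.Theory.
Import numFieldNormedType.Exports.
Set Implicit Arguments.
Unset Strict Implicit.
Unset Printing Implicit Defensive.
Local Open Scope classical_set_scope.
Local Open Scope ring_scope.

Section cover_outer.
Context {R : realType} {I : choiceType} {T : Type}.
Variables (cell : I -> set T) (w : I -> \bar R) (C : set I).

(* Covers are countable families rather than sequences: the empty family has
   to be allowed, as in dimension 0 no box is empty. *)
Definition countable_cover (A : set T) : set (set I) :=
  [set F | [/\ countable F, F `<=` C & A `<=` \bigcup_(i in F) cell i]].

Definition cover_outer (A : set T) : \bar R :=
  ereal_inf [set (\esum_(i in F) w i)%E | F in countable_cover A].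

Hypothesis w0 : forall i, C i -> (0 <= w i)%E.

Lemma cover_outer_ge0 A : (0 <= cover_outer A)%E.
Proof.
apply: le_ereal_inf_tmp => _ [F [_ FC _] <-].
by apply: esum_ge0 => i /FC; exact: w0.
Qed.

Lemma cover_outer0 : cover_outer set0 = 0%E.
Proof.
apply/eqP; rewrite eq_le cover_outer_ge0 andbT.
by apply: ereal_inf_lbound; exists set0; [split|rewrite esum_set0].
Qed.

Lemma esum_bigcup_le (F : nat -> set I) : (forall n, F n `<=` C) ->
  (\esum_(i in \bigcup_n F n) w i <= \sum_(n <oo) \esum_(i in F n) w i)%E.
Proof.
move=> FC; pose w' i := if i \in C then w i else 0%E.
have w'0 i : (0 <= w' i)%E.
  by rewrite /w'; case: ifPn => // /set_mem; exact: w0.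
have w'E (J : set I) : J `<=` C ->
    (\esum_(i in J) w i = \esum_(i in J) w' i)%E.
  by move=> JC; apply: eq_esum => i /JC Ci; rewrite /w' mem_set.
rewrite w'E; last by move=> i [n _ /FC].
rewrite seqDU_bigcup_eq nneseries_sum_bigcup//.
apply: lee_nneseries => [n _ _|n _]; first by apply: esum_ge0.
rewrite w'E// esum_mkcond [leRHS]esum_mkcond; apply: le_esum => i _.
case: ifPn => [/set_mem Fi|_]; last by case: ifP.
by rewrite mem_set//; exact: (@subset_seqDU _ F n).
Qed.

Lemma cover_outer_subadditive A (G : (set T)^nat) :
  subset_sigma_subadditive cover_outer A G.
Proof.
move=> AG; have [[i ioo]|] := pselect (exists i, cover_outer (G i) = +oo%E).
  by rewrite (eseries_pinfty _ _ ioo) ?leey// => n _;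
    rewrite -ltNye (lt_le_trans _ (cover_outer_ge0 _)).
rewrite -forallNE => Goo.
suff add2e (e : {posnum R}) :
    (cover_outer A <= \sum_(i <oo) cover_outer (G i) + e%:num%:E)%E.
  by apply/lee_addgt0Pr => _/posnumP[].
rewrite (le_trans _ (epsilon_trick _ _ _))//; last first.
  by move=> n; exact: cover_outer_ge0.
pose P n (B : set I) := countable_cover (G n) B /\
  (\esum_(i in B) w i <= cover_outer (G n) + (e%:num / (2 ^ n.+1)%:R)%:E)%E.
have [F PF] : {F : (set I)^nat & forall n, P n (F n)}.
  apply: (@choice _ _ P) => n.
  have en1 : 0 < e%:num / (2 ^ n.+1)%:R :> R by [].
  have fG : cover_outer (G n) \is a fin_num.
    by rewrite ge0_fin_numE ?cover_outer_ge0// ltey; apply/eqP/Goo.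
  have [_ [B cB <-] ltB] := lb_ereal_inf_adherent en1 fG.
  by exists B; split => //; exact/ltW.
apply: (@le_trans _ _ (\esum_(i in \bigcup_n F n) w i)%E).
  apply: ereal_inf_lbound; exists (\bigcup_n F n) => //; split.
  - by apply: bigcup_countable => // n _; case: (PF n) => -[].
  - by move=> i [n _ Fi]; case: (PF n) => -[_ + _] _; exact.
  - move=> x /AG[n _ Gx]; case: (PF n) => -[_ _ /(_ _ Gx)[i Fi ix]] _.
    by exists i => //; exists n.
apply: le_trans (esum_bigcup_le _) _; first by move=> n; case: (PF n) => -[].
apply: lee_nneseries => [n _ _|n _]; last by case: (PF n).
by apply: esum_ge0 => i Fi; apply: w0; case: (PF n) => -[_ + _] _; exact.
Qed.

End cover_outer.

Section lebesgue.
Context {R : realType} {n : nat}.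

Definition box (ab : 'rV[R]_n * 'rV[R]_n) : set 'rV[R]_n :=
  [set x : 'rV[R]_n | forall i, ab.1 0 i < x 0 i <= ab.2 0 i].

Definition box_volume (ab : 'rV[R]_n * 'rV[R]_n) : \bar R :=
  (\prod_(i < n) (ab.2 0 i - ab.1 0 i))%:E.

Definition box_bounds : set ('rV[R]_n * 'rV[R]_n) :=
  [set ab : 'rV[R]_n * 'rV[R]_n | forall i, ab.1 0 i <= ab.2 0 i].

Definition lebesgue_outer : set 'rV[R]_n -> \bar R :=
  cover_outer box box_volume box_bounds.

Lemma box_volume_ge0 ab : box_bounds ab -> (0 <= box_volume ab)%E.
Proof. by move=> h; rewrite lee_fin prodr_ge0// => i _; rewrite subr_ge0. Qed.

Lemma lebesgue_outer0 : lebesgue_outer set0 = 0%E.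
Proof. by apply: cover_outer0; exact: box_volume_ge0. Qed.

Lemma lebesgue_outer_ge0 A : (0 <= lebesgue_outer A)%E.
Proof. by apply: cover_outer_ge0; exact: box_volume_ge0. Qed.

Lemma lebesgue_outer_subadditive A F : subset_sigma_subadditive lebesgue_outer A F.
Proof. by apply: cover_outer_subadditive; exact: box_volume_ge0. Qed.

HB.instance Definition _ := isSubsetOuterMeasure.Build R 'rV[R]_n lebesgue_outer
  lebesgue_outer0 lebesgue_outer_ge0 lebesgue_outer_subadditive.

End lebesgue.

Section hausdorff.
Context {R : realType} {n : nat}.

(* The norm that the library puts on row vectors is the sup norm. *)
Definition edist (x y : 'rV[R]_n) : R :=
  Num.sqrt (\sum_(i < n) (x 0 i - y 0 i) ^+ 2).

(* The value 0 is added so that the empty set has diameter 0, not -oo. *)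
Definition diam (U : set 'rV[R]_n) : \bar R :=
  ereal_sup ([set 0%E] `|` [set (edist z.1 z.2)%:E | z in U `*` U]).

(* With the convention 0 ^ 0 = 1 of poweR, so that p = 0 counts points. *)
Definition hausdorff_delta (p d : R) : set 'rV[R]_n -> \bar R :=
  cover_outer id (fun U => poweR (diam U) p) [set U | (diam U < d%:E)%E].

Definition hausdorff (p : R) (E : set 'rV[R]_n) : \bar R :=
  lim (hausdorff_delta p d E @[d --> 0^'+]).

Variable p : R.

Let w0 (d : R) U : [set U | (diam U < d%:E)%E] U -> (0 <= poweR (diam U) p)%E.
Proof. by move=> _; exact: poweR_ge0. Qed.

Lemma hausdorff_delta_cvg E : hausdorff_delta p d E @[d --> 0^'+] -->
  ereal_sup [set hausdorff_delta p d E | d in `]0, +oo[].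
Proof.
apply: nonincreasing_at_right_cvge => // d1 d2 _ _ d12.
apply: ereal_inf_le_tmp => _ [F [cF Fd EF] <-]; exists F => //; split => // U /Fd /=.
by move=> /lt_le_trans; apply; rewrite lee_fin.
Qed.

Lemma hausdorffE E :
  hausdorff p E = ereal_sup [set hausdorff_delta p d E | d in `]0, +oo[].
Proof. by apply/cvg_lim => //; exact: hausdorff_delta_cvg. Qed.

Lemma hausdorff0 : hausdorff p set0 = 0%E.
Proof.
rewrite hausdorffE; apply/eqP; rewrite eq_le; apply/andP; split.
  by apply: ge_ereal_sup => _ [d _ <-]; rewrite /hausdorff_delta cover_outer0//;
    exact: w0.
apply: ereal_sup_ubound; exists 1; first by rewrite /= in_itv/= ltr01.
by rewrite /hausdorff_delta cover_outer0//; exact: w0.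
Qed.

Lemma hausdorff_ge0 E : (0 <= hausdorff p E)%E.
Proof.
rewrite hausdorffE; apply: (@le_trans _ _ (hausdorff_delta p 1 E)).
  exact/cover_outer_ge0/w0.
by apply: ereal_sup_ubound; exists 1 => //; rewrite /= in_itv/= ltr01.
Qed.

Lemma hausdorff_subadditive A F : subset_sigma_subadditive (hausdorff p) A F.
Proof.
move=> AF; rewrite [leLHS]hausdorffE; apply: ge_ereal_sup => _ [d d0 <-].
apply: (@le_trans _ _ (\sum_(i <oo) hausdorff_delta p d (F i))%E).
  by apply: cover_outer_subadditive => //; exact: w0.
apply: lee_nneseries => [i _ _|i _]; first exact/cover_outer_ge0/w0.
by rewrite hausdorffE; apply: ereal_sup_ubound; exists d.
Qed.

HB.instance Definition _ := isSubsetOuterMeasure.Build R 'rV[R]_n (hausdorff p)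
  hausdorff0 hausdorff_ge0 hausdorff_subadditive.

End hausdorff.

(* The library's measurable types are pointed, which a subspace such as the
   graph of a function need not be. *)
Record measured_space (R : realType) := MeasuredSpace {
  ms_space :> topologicalType;
  ms_sets : set (set ms_space);
  ms_measure : set ms_space -> \bar R;
  ms_sigma_algebra : sigma_algebra setT ms_sets;
  ms_measure0 : ms_measure set0 = 0%E;
  ms_measure_ge0 : forall A, ms_sets A -> (0 <= ms_measure A)%E;
  ms_sigma_additive : forall F : (set ms_space)^nat,
    (forall i, ms_sets (F i)) -> trivIset setT F ->
    (\sum_(0 <= i < k) ms_measure (F i))%E @[k --> \oo] -->
      ms_measure (\bigcup_i F i) }.

Section graph_space.
Context {R : realType} {n : nat} {T : finType}.
Variables (m : {outer_measure set 'rV[R]_n -> \bar R}) (D : set 'rV[R]_n).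
Hypothesis mD : m.-caratheodory D.
Variable f : 'rV[R]_n -> T.

Definition graph : set ('rV[R]_n * discrete_topology T) :=
  [set (x, f x) | x in D].

(* Preimage under D -> graph, x |-> (x, f x), the map along which graph_sets
   and graph_measure push forward the m-measurable subsets of D and m. *)
Definition graph_preimage (A : set graph) : set 'rV[R]_n :=
  [set x | D x /\ (set_val @` A) (x, f x)].

Definition graph_sets : set (set graph) :=
  [set A | m.-caratheodory (graph_preimage A)].

Definition graph_measure (A : set graph) : \bar R := m (graph_preimage A).

Lemma graph_preimage_bigcup (F : (set graph)^nat) :
  graph_preimage (\bigcup_i F i) = \bigcup_i graph_preimage (F i).
Proof.
apply/seteqP; split => x /=.
  by move=> [Dx [z [i _ Fz] zx]]; exists i => //; split => //; exists z.
by move=> [i _ [Dx [z Fz zx]]]; split => //; exists z => //; exists i.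
Qed.

Lemma graph_preimage0 : graph_preimage set0 = set0.
Proof. by apply/seteqP; split => x //= [_ []]. Qed.

Lemma graph_preimageC (A : set graph) :
  graph_preimage (setT `\` A) = D `\` graph_preimage A.
Proof.
apply/seteqP; split => x /=.
  move=> [Dx [z [_ nAz] zx]]; split => // -[_ [z' Az' z'x]].
  by apply: nAz; rewrite (_ : z = z')//; apply: val_inj;
    exact: (etrans zx (esym z'x)).
move=> [Dx nA]; split => //.
have gx : (x, f x) \in graph by apply: mem_set; exists x.
by exists (SigSub gx) => //; split => // Az; apply: nA; split => //;
  exists (SigSub gx).
Qed.

Lemma graph_sigma_algebra : sigma_algebra setT graph_sets.
Proof.
split.
- by rewrite /graph_sets /= graph_preimage0; exact: caratheodory_measurable_set0.
- by move=> A mA; rewrite /graph_sets /= graph_preimageC; exact: caratheodory_measurable_setD.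
- move=> F mF; rewrite /graph_sets /= graph_preimage_bigcup.
  exact: caratheodory_measurable_bigcup.
Qed.

Lemma graph_sigma_additive (F : (set graph)^nat) :
  (forall i, graph_sets (F i)) -> trivIset setT F ->
  (\sum_(0 <= i < k) graph_measure (F i))%E @[k --> \oo] --> graph_measure (\bigcup_i F i).
Proof.
move=> mF tF; rewrite /graph_measure graph_preimage_bigcup.
have mm := @caratheodory_measure_sigma_additive R 'rV[R]_n m
  (graph_preimage \o F).
apply: mm => //; last exact: caratheodory_measurable_bigcup.
move=> i j _ _ [x [[_ [z Fz zx]] [_ [z' Fz' z'x]]]].
apply: (tF i j) => //; exists z; split => //.
by rewrite (_ : z = z')//; apply: val_inj;
    exact: (etrans zx (esym z'x)).
Qed.

Definition graph_space : measured_space R :=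
  @MeasuredSpace R graph graph_sets graph_measure graph_sigma_algebra
    (etrans (congr1 m graph_preimage0) (outer_measure0 m))
    (fun A _ => outer_measure_ge0 m (graph_preimage A)) graph_sigma_additive.

End graph_space.

Section measure_preserving.
Context {R : realType} {X Y : measured_space R} {U : set X}.

Definition measure_preserving_homeomorphism (phi : U -> Y) :=
  exists psi : Y -> U,
    [/\ cancel phi psi, cancel psi phi, continuous phi, continuous psi &
        forall B : set Y,
          (ms_sets B <-> ms_sets (set_val @` (phi @^-1` B))) /\
          (ms_sets B ->
            ms_measure (set_val @` (phi @^-1` B)) = ms_measure B)].

End measure_preserving.

Definition affine_map {R : realType} {n k : nat} (l : 'rV[R]_n -> 'rV[R]_k) :=
  exists W b, forall x, l x = x *m W + b.

(* The sign s i is true on 0 <= l_i and false on l_i < 0. *)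
Definition chambers {R : realType} {n k : nat} (l : 'rV[R]_n -> 'rV[R]_k) :
    set (set 'rV[R]_n) :=
  [set C | C !=set0 /\
    exists s : 'I_k -> bool, C = [set x | forall i, (0 <= l x 0 i) = s i]].

Section linear_logical.
Context {R : realType} {n : nat} {T : finType}.

(* llg_k, llg_l are meaningful at the vertices with more than one outgoing
   arrow, and llg_chamber at the arrows leaving such vertices; the other values
   are irrelevant, as are those of llg_label outside the target vertices. *)
Record linear_logical_graph := LinearLogicalGraph {
  llg_vertex : finType;
  llg_arrow : finType;
  llg_src : llg_arrow -> llg_vertex;
  llg_tgt : llg_arrow -> llg_vertex;
  llg_source : llg_vertex;
  llg_label : llg_vertex -> T;
  llg_k : llg_vertex -> nat;
  llg_l : forall v, 'rV[R]_n -> 'rV[R]_(llg_k v);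
  llg_chamber : llg_arrow -> set 'rV[R]_n;
  llg_out := fun v => [pred a | llg_src a == v];
  llg_acyclic : forall c : seq llg_vertex,
    cycle (fun u v => [exists a, (llg_src a == u) && (llg_tgt a == v)]) c ->
    c = [::];
  llg_sourceP : forall v, v = llg_source <-> forall a, llg_tgt a <> v;
  llg_targetP : set_bij [set v | #|llg_out v| = 0%N] [set: T] llg_label;
  llg_affine : forall v, (1 < #|llg_out v|)%N -> affine_map (@llg_l v);
  llg_chamberP : forall v, (1 < #|llg_out v|)%N ->
    set_bij [set a | llg_src a = v] (chambers (@llg_l v)) llg_chamber }.

Variable G : linear_logical_graph.

Definition llg_follows (x : 'rV[R]_n) (a : llg_arrow G) : Prop :=
  (1 < #|llg_out (llg_src a)|)%N -> llg_chamber a x.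

Definition llg_next (x : 'rV[R]_n) (v : llg_vertex G) : llg_vertex G :=
  if [pick a in llg_out v | `[< llg_follows x a >]] is Some a
  then llg_tgt a else v.

(* Targets are fixed by llg_next, and by acyclicity every walk has reached one
   after #|llg_vertex G| steps. *)
Definition llg_fun (x : 'rV[R]_n) : T :=
  llg_label (iter #|llg_vertex G| (llg_next x) (llg_source G)).

End linear_logical.
Arguments linear_logical_graph R n T : clear implicits.

Definition linear_logical {R : realType} {n : nat} {T : finType}
    (D : set 'rV[R]_n) (f : 'rV[R]_n -> T) :=
  exists G : linear_logical_graph R n T, forall x, D x -> f x = llg_fun G x.

Section logifold.
Context {R : realType}.

Record chart (X : measured_space R) := Chart {
  chart_dom : set X;
  chart_dom_measurable : ms_sets chart_dom;
  chart_dom_gt0 : (0 < ms_measure chart_dom)%E;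
  chart_n : nat;
  chart_p : R;
  chart_p_ge0 : 0 <= chart_p;
  chart_D : set 'rV[R]_chart_n;
  chart_D_measurable : (hausdorff chart_p).-caratheodory chart_D;
  chart_T : finType;
  chart_f : 'rV[R]_chart_n -> chart_T;
  chart_f_linear_logical : linear_logical chart_D chart_f;
  chart_phi : chart_dom -> graph_space chart_D_measurable chart_f;
  chart_phiP : measure_preserving_homeomorphism chart_phi }.

Record linear_logifold_structure (X : measured_space R) := LinearLogifold {
  logifold_index : Type;
  logifold_chart : logifold_index -> chart X;
  logifold_rest := ~` \bigcup_i chart_dom (logifold_chart i);
  logifold_rest_measurable : ms_sets logifold_rest;
  logifold_rest0 : ms_measure logifold_rest = 0%E }.

Definition entire_up_to (X : measured_space R) (eps : R) (c : chart X) :=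
  (ms_measure (~` chart_dom c) < eps%:E)%E.

End logifold.

(* Main.v *)
Require Import Defs.
From HB Require Import structures.
From mathcomp Require Import all_boot all_order all_algebra.
From mathcomp Require Import all_classical all_reals all_analysis.
From mathcomp Require Import ring lra.
Import Order.TTheory GRing.Theory Num.Theory.
Import numFieldNormedType.Exports.
Set Implicit Arguments.
Unset Strict Implicit.
Unset Printing Implicit Defensive.
Local Open Scope classical_set_scope.
Local Open Scope ring_scope.

(** A measurable f agrees, off a set of small measure, with a function that is
    determined by the signs of finitely many affine forms. Indeed each level
    set of f is a finite union of boxes up to small measure
    ([finite_box_approximation]), and membership in a box is read off from the
    signs of c_i - x_i for the corners c of the box
    ([sign_determined_approximation]). A surjective function of this kind is
    linear logical through a graph with a single branching vertex, whose arrows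
    are the nonempty sign patterns ([sign_determined_linear_logical]).
    Surjectivity matters because a target without incoming arrow would be a
    second source; the set of targets of the chart is therefore cut down to the
    values that are taken. On the set U where f agrees with its approximation,
    the graph of f is the domain of the chart that is entire up to epsilon. The
    level sets of f of positive measure, on which f is constant, give finitely
    many further charts, and these cover the graph up to measure zero.

    What remains is to compare measures: the graph carries Lebesgue measure L,
    whereas the domain of a chart carries the Hausdorff measure H^n, which is
    defined without a normalizing constant. They satisfy H^n = k L with
    k = H^n(unit cube), so that the dilation of ratio k ^ (-1/n) carries L to
    H^n ([hausdorff_scaled_eq_lebesgue]). In dimension 0, where dilations do
    nothing, k = 1.

    The bound H^n <= k L holds because a cube of side r has H^n-measure k r^n by
    homogeneity and because small cubes tile a box almost without waste. The
    reverse bound follows for a measurable subset B of a cube Q from the first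
    one applied to the complement of B in Q, then for all measurable sets by
    exhaustion, and finally for arbitrary sets because every set is contained
    in a Borel set of the same Hausdorff measure ([hausdorff_lebesgue_hull]).
    The equality has to hold on all sets, not only on measurable ones: this is
    what identifies the two Caratheodory sigma-algebras
    ([caratheodory_image]). *)

(** * Upper bounds for outer measures defined by covers *)

Section cover_outer_theory.
Context {R : realType} {I : choiceType} {T : Type}.

Lemma subset_subadditive_esum (m : set T -> \bar R) (cell : I -> set T)
    (F : set I) (A : set T) :
  m set0 = 0%E -> (forall X, (0 <= m X)%E) ->
  (forall X G, subset_sigma_subadditive m X G) ->
  countable F -> A `<=` \bigcup_(i in F) cell i ->
  (m A <= \esum_(i in F) m (cell i))%E.
Proof.
move=> m0 mge0 msub /countable_injP[e einj] AF.
pose G k := \bigcup_(i in F `&` e @^-1` [set k]) cell i.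
have GE i : F i -> G (e i) = cell i.
  move=> Fi; apply/seteqP; split=> [x [j [Fj /= eji] jx]|x ix];
    last by exists i.
  by rewrite -(einj _ _ _ _ eji) ?inE.
apply: (@le_trans _ _ (\sum_(k <oo) m (G k))%E).
  by apply: msub => x /AF[i Fi ix]; exists (e i) => //; rewrite GE.
rewrite nneseries_esumT// (esumID (e @` F))//= setTI [X in (_ + X)%E]esum1.
  rewrite adde0 esum_image; first by apply: le_esum => i /GE ->.
  exact: einj.
move=> k [_ nk]; rewrite (_ : G k = set0)// -subset0 => x [i [Fi /= ek] _].
by apply: nk; exists i.
Qed.

(** An outer measure given by covers is the largest one below its weights, up to
    a factor: a bound on the cells extends to all sets by subadditivity along a
    cover. The comparisons between Lebesgue measure, Hausdorff measure and their
    images under maps rest on it. *)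
Lemma le_cover_outer (m : set T -> \bar R) (cell : I -> set T) (w : I -> \bar R)
    (C : set I) (k : R) (A : set T) :
  m set0 = 0%E -> (forall X, (0 <= m X)%E) ->
  (forall X G, subset_sigma_subadditive m X G) ->
  0 < k -> (forall i, C i -> (m (cell i) <= k%:E * w i)%E) ->
  (m A <= k%:E * cover_outer cell w C A)%E.
Proof.
move=> m0 mge0 msub k0 mw; rewrite -lee_pdivrMl//.
apply: le_ereal_inf_tmp => _ [F [cF FC AF] <-].
rewrite lee_pdivrMl//.
apply: (le_trans (subset_subadditive_esum m0 mge0 msub cF AF)).
have kw i : F i -> (m (cell i) <= k%:E * w i)%E by move=> /FC /mw.
have w0 i : F i -> (0 <= w i)%E.
  by move=> /kw; move/(le_trans (mge0 _)); rewrite pmule_rge0// lte_fin.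
apply: (le_trans (le_esum kw)).
apply: ge_ereal_sup => _ [X [finX XF] <-].
rewrite fsbig_finite//= big_seq -ge0_sume_distrr; last first.
  by move=> i; rewrite in_fset_set// inE => /XF; exact: w0.
rewrite -big_seq -fsbig_finite// lee_pmul2l ?lte_fin//.
by apply: ereal_sup_ubound; exists X.
Qed.

End cover_outer_theory.

(** * Lebesgue measurability of boxes and open sets *)

Section boxes.
Context {R : realType} {n : nat}.
Notation leb := (@lebesgue_outer R n).
Implicit Types (A B : set 'rV[R]_n) (ab : 'rV[R]_n * 'rV[R]_n).

Lemma lebesgue_outer_box_le ab : box_bounds ab ->
  (leb (box ab) <= box_volume ab)%E.
Proof.
move=> Cab; apply: ereal_inf_lbound; exists [set ab].
  split; first exact: countable1.
    by move=> _ ->.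
  by move=> x abx; exists ab.
by rewrite esum_set1// box_volume_ge0.
Qed.

Lemma le_lebesgue_outer A (m : set 'rV[R]_n -> \bar R) (k : R) :
  m set0 = 0%E -> (forall X, (0 <= m X)%E) ->
  (forall X G, subset_sigma_subadditive m X G) ->
  0 < k ->
  (forall ab, box_bounds ab -> (m (box ab) <= k%:E * box_volume ab)%E) ->
  (m A <= k%:E * leb A)%E.
Proof. exact: le_cover_outer. Qed.

(** A coordinate hyperplane cuts a box into two boxes whose volumes add up, so
    X |-> L(X in h) + L(X outside h) is subadditive and bounded on boxes by the
    volume, hence bounded by L. *)
Lemma halfspace_measurable (i : 'I_n) (c : R) :
  leb.-caratheodory [set x : 'rV[R]_n | x 0 i <= c].
Proof.
set h := [set x | _].
apply: le_caratheodory_measurable => X.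
pose m X := (leb (X `&` h) + leb (X `&` ~` h))%E.
rewrite -[leRHS]mul1e; apply: (@le_lebesgue_outer X m) => //.
- by rewrite /m !set0I outer_measure0 adde0.
- by move=> Y; rewrite /m adde_ge0// outer_measure_ge0.
- move=> Y G YG; rewrite /m.
  apply: (@le_trans _ _ (\sum_(k <oo) leb (G k `&` h) +
                         \sum_(k <oo) leb (G k `&` ~` h))%E).
    by apply: leeD; apply: lebesgue_outer_subadditive => x [/YG[k _ Gx] hx];
      exists k.
  by rewrite nneseriesD// => k _ _; exact: outer_measure_ge0.
move=> [a b] Cab; rewrite mul1e /m.
have [cb|bc] := leP (b 0 i) c.
  rewrite (_ : _ `&` ~` h = set0) ?outer_measure0 ?adde0; last first.
    rewrite -subset0 => x [abx nhx]; apply: nhx.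
    by rewrite /h /=; have /andP[_ bx] := abx i; exact: le_trans bx cb.
  apply: (@le_trans _ _ (leb (box (a, b)))); last exact: lebesgue_outer_box_le.
  by apply: le_outer_measure; exact: subIsetl.
have [ca|ac] := leP c (a 0 i).
  rewrite (_ : _ `&` h = set0) ?outer_measure0 ?add0e; last first.
    rewrite -subset0 => x [/= abx] hx.
    by have /andP[/(le_lt_trans ca)/lt_geF/= + _] := abx i; rewrite hx.
  apply: (@le_trans _ _ (leb (box (a, b)))); last exact: lebesgue_outer_box_le.
  by apply: le_outer_measure; exact: subIsetl.
pose b' := \row_j (if j == i then c else b 0 j).
pose a' := \row_j (if j == i then c else a 0 j).
apply: (@le_trans _ _ (box_volume (a, b') + box_volume (a', b))%E).
  apply: leeD.
    apply: (@le_trans _ _ (leb (box (a, b')))).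
      apply: le_outer_measure => x [/= abx cx] j /=; rewrite mxE.
      by have /andP[-> bx] := abx j; case: eqP => // ->.
    apply: lebesgue_outer_box_le => j /=; rewrite mxE.
    by case: eqP => [->|_]; [exact: ltW|exact: Cab].
  apply: (@le_trans _ _ (leb (box (a', b)))).
    apply: le_outer_measure => x [/= abx /negP cx] j /=; rewrite mxE.
    by have /andP[ax ->] := abx j; rewrite andbT; case: eqP => // ->;
      rewrite ltNge.
  apply: lebesgue_outer_box_le => j /=; rewrite mxE.
  by case: eqP => [->|_]; [exact: ltW|exact: Cab].
rewrite /box_volume/= -EFinD lee_fin (bigD1 i)//= [in X in _ + X](bigD1 i)//=.
rewrite [in leRHS](bigD1 i)//= !mxE eqxx.
rewrite (eq_bigr (fun j => b 0 j - a 0 j)) => [|j /negbTE ji];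
  last by rewrite mxE ji.
rewrite [X in _ + _ * X](eq_bigr (fun j => b 0 j - a 0 j)) => [|j /negbTE ji];
  last by rewrite mxE ji.
by rewrite -mulrDl le_eqVlt; apply/orP; left; apply/eqP; congr (_ * _); ring.
Qed.

Lemma box_measurable ab : leb.-caratheodory (box ab).
Proof.
rewrite (_ : box ab = \bigcap_(i in [set: 'I_n])
  ([set x | x 0 i <= ab.2 0 i] `\` [set x | x 0 i <= ab.1 0 i])).
  apply: (@fin_bigcap_measurable _ (caratheodory_type leb)) => [|i _].
    exact: finite_finset.
  by apply: caratheodory_measurable_setD; exact: halfspace_measurable.
apply/seteqP; split=> x /=.
  by move=> abx i _ /=; have /andP[ax ->] := abx i; split=> //; apply/negP;
    rewrite -ltNge.
by move=> abx i; have [/= -> /negP] := abx i I; rewrite -ltNge => ->.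
Qed.

Definition cube (a : 'rV[R]_n) (r : R) : 'rV[R]_n * 'rV[R]_n :=
  (a, a + const_mx r).

Definition grid_vertex (r : R) (z : {ffun 'I_n -> int}) : 'rV[R]_n :=
  \row_i ((z i)%:~R * r).

Lemma cube_bounds a r : 0 <= r -> box_bounds (cube a r).
Proof. by move=> r0 i; rewrite /= !mxE lerDl. Qed.

Lemma cube_volume a r : box_volume (cube a r) = (r ^+ n)%:E.
Proof.
congr (_%:E); rewrite (eq_bigr (fun=> r)) => [|i _]; last first.
  by rewrite !mxE addrAC subrr add0r.
by rewrite prodr_const card_ord.
Qed.

Lemma mem_grid_cube (r : R) (x : 'rV[R]_n) : 0 < r ->
  box (cube (grid_vertex r [ffun i => Num.ceil (x 0 i / r) - 1]) r) x.
Proof.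
move=> r0 i; have /andP[h1 h2] := ceil_itv (x 0 i / r).
rewrite !mxE ffunE -ltr_pdivlMr// h1 rmorphB/= mulrBl mul1r subrK.
by rewrite -ler_pdivrMr.
Qed.

Lemma cube_near (r : R) (a x y : 'rV[R]_n) i :
  box (cube a r) x -> box (cube a r) y -> `|x 0 i - y 0 i| < r.
Proof.
move=> /(_ i) + /(_ i); rewrite !mxE => /andP[? ?] /andP[? ?].
by rewrite ltr_norml; apply/andP; split; lra.
Qed.

(** An open set is the union of the countably many cells of the grids of mesh
    1/(k+1) that it contains. *)
Lemma open_measurable_lebesgue_outer (O : set 'rV[R]_n) : open O ->
  leb.-caratheodory O.
Proof.
move=> oO.
pose e k : R := k.+1%:R^-1.
have e0 k : 0 < e k by rewrite invr_gt0 ltr0n.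
pose cell (kz : nat * {ffun 'I_n -> int}) :=
  cube (grid_vertex (e kz.1) kz.2) (e kz.1).
pose P := [set kz | box (cell kz) `<=` O].
rewrite (_ : O = \bigcup_(kz in P) box (cell kz)).
  rewrite bigcup_mkcond.
  apply: (@countable_bigcupT_measurable _ (caratheodory_type leb)) => // kz.
  case: ifP => _; first exact: box_measurable.
  exact: caratheodory_measurable_set0.
apply/seteqP; split=> [x Ox|x [kz]]; last exact.
have /nbhs_ballP[d /= d0 dO] : nbhs x O by rewrite nbhsE/=; exists O.
near \oo => k.
exists (k, [ffun i => Num.ceil (x 0 i / e k) - 1]); last exact: mem_grid_cube.
move=> y yk; have xy i := cube_near i (mem_grid_cube x (e0 k)) yk; apply: dO.
split=> // i j; rewrite ord1; apply: (lt_trans (xy j)).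
by near: k; exact: (near_infty_natSinv_lt (PosNum d0)).
Unshelve. all: by end_near. Qed.

End boxes.

(** * Cutting a box into small cubes *)

Section grid.
Context {R : realType} {n : nat}.
Implicit Types (m : {outer_measure set 'rV[R]_n -> \bar R}).

Lemma outer_measure_bigsetU_le T (I : finType) (P : pred I) (A : I -> set T)
    (mu : {outer_measure set T -> \bar R}) :
  (mu (\big[setU/set0]_(i | P i) A i) <= \sum_(i | P i) mu (A i))%E.
Proof.
apply: (big_ind2 (fun X y => (mu X <= y)%E)) => // [|X x Y y Xx Yy].
  by rewrite outer_measure0.
by apply: le_trans (leeD Xx Yy); exact: outer_measureU2.
Qed.

(** A box is covered by cubes of side r, ceil((b_i - a_i)/r) of them along the
    axis i, hence with total volume at most that of the box enlarged by r. *)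
Lemma outer_measure_box_grid m (w r : R) ab :
  box_bounds ab -> 0 <= w -> 0 < r ->
  (forall a, (m (box (cube a r)) <= (w * r ^+ n)%:E)%E) ->
  (m (box ab) <= (w * \prod_(i < n) (ab.2 0 i - ab.1 0 i + r))%:E)%E.
Proof.
move=> Cab w0 r0 mw.
pose q i := (ab.2 0 i - ab.1 0 i) / r.
have q0 i : 0 <= q i by rewrite divr_ge0 ?subr_ge0// ltW.
pose N i := `|Num.ceil (q i)|%N.
have NE i : (N i)%:Z = Num.ceil (q i) by
  rewrite gez0_abs// ceil_ge0 (lt_le_trans _ (q0 i)).
pose M := (\max_i N i)%N.
pose Q i : pred 'I_M := fun j => (j < N i)%N.
pose a (f : {ffun 'I_n -> 'I_M}) : 'rV[R]_n := \row_i (ab.1 0 i + (f i)%:R * r).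
apply: (@le_trans _ _ (m (\big[setU/set0]_(f in family Q) box (cube (a f) r)))).
  apply: le_outer_measure => x abx.
  pose k i := `|Num.ceil ((x 0%R i - ab.1 0%R i) / r) - 1|%N.
  have kE i : (k i)%:Z = Num.ceil ((x 0 i - ab.1 0 i) / r) - 1.
    rewrite gez0_abs// subr_ge0 -gtz0_ge1 ceil_gt0 divr_gt0// subr_gt0.
    by have /andP[] := abx i.
  have kN i : (k i < N i)%N.
    rewrite -ltz_nat kE NE ltrBlDr ltzD1 ceil_le// ler_pM2r ?invr_gt0// lerB//.
    by have /andP[] := abx i.
  have kM i : (k i < M)%N by apply: leq_trans (kN i) _; exact: leq_bigmax.
  pose f := [ffun i => Ordinal (kM i)].
  rewrite (bigD1 f) /=; last by apply/familyP => i; rewrite ffunE; exact: kN.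
  left => i; rewrite /cube/= !mxE ffunE /=.
  have := ceil_itv ((x 0 i - ab.1 0 i) / r).
  rewrite -kE -[in X in _ < _ <= X](subrK 1 (Num.ceil _)) -kE.
  rewrite rmorphD/= -!pmulrn.
  rewrite ltr_pdivlMr// ler_pdivrMr// mulrDl mul1r => /andP[? ?].
  by apply/andP; split; lra.
apply: le_trans (outer_measure_bigsetU_le _ _ m) _.
apply: (@le_trans _ _ (\sum_(f in family Q) (w * \prod_(i < n) r)%:E)%E).
  by apply: lee_sum => f _; rewrite prodr_const card_ord.
rewrite sumEFin lee_fin -mulr_sumr ler_wpM2l//.
rewrite -(bigA_distr_big_dep _ (fun _ _ => r)); apply: ler_prod => i _.
rewrite sumr_ge0 => [/=|? _]; last exact: ltW.
rewrite -(big_ord_widen _ (fun=> r)) ?leq_bigmax//.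
rewrite sumr_const card_ord -[r *+ _]mulr_natl pmulrn NE.
have := ceilB1_lt (q i); rewrite rmorphB/= ltrBlDr => h.
apply: le_trans (ltW (_ : _ < (q i + 1) * r)) _; first by rewrite ltr_pM2r.
by rewrite mulrDl mul1r /q divfK// gt_eqF.
Qed.

Lemma cvg_prodDr (c : 'I_n -> R) :
  \prod_(i < n) (c i + r) @[r --> 0^'+] --> \prod_(i < n) c i.
Proof.
pose p := \prod_(i < n) ((c i)%:P + 'X) : {poly R}.
have pE r : p.[r] = \prod_(i < n) (c i + r).
  by rewrite horner_prod; apply: eq_bigr => i _; rewrite !hornerE.
rewrite (_ : (fun r => _) = horner p); last by apply/funext => r; rewrite pE.
rewrite (_ : \prod_(i < n) c i = p.[0]); last first.
  by rewrite pE; apply: eq_bigr => i _; rewrite addr0.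
by apply: cvg_at_right_filter; exact: continuous_horner.
Qed.

(** A volume bound on all small cubes passes to boxes: in the grid estimate the
    enlargement of the box tends to 0 with the mesh. Only cubes of side below d
    are tested, because this is applied to the outer measures
    [hausdorff_delta p d], which control small cubes only. *)
Lemma le_outer_measure_box m (w d : R) ab : box_bounds ab -> 0 <= w -> 0 < d ->
  (forall r a, 0 < r < d -> (m (box (cube a r)) <= (w * r ^+ n)%:E)%E) ->
  (m (box ab) <= w%:E * box_volume ab)%E.
Proof.
move=> Cab w0 d0 mw.
have H r : 0 < r < d ->
    (m (box ab) <= (w * \prod_(i < n) (ab.2 0 i - ab.1 0 i + r))%:E)%E.
  move=> rd; have /andP[r0 _] := rd.
  by apply: outer_measure_box_grid => // a; exact: mw.
have mfin : m (box ab) \is a fin_num.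
  rewrite ge0_fin_numE ?outer_measure_ge0//; apply: le_lt_trans (H (d / 2) _) _.
    by rewrite divr_gt0//= ltr_pdivrMr// ltr_pMr// ltr1n.
  exact: ltry.
rewrite -(fineK mfin) /box_volume -EFinM lee_fin.
apply: (@cvgr_to_ge _ (0^'+)
  _ _ (fun r => w * \prod_(i < n) (ab.2 0 i - ab.1 0 i + r))).
  by apply: cvgMr; exact: cvg_prodDr.
near=> r; rewrite -lee_fin fineK//; apply: H; apply/andP; split=> //.
Unshelve. all: by end_near. Qed.

End grid.

(** * Euclidean distance and diameter *)

(** [edist] alone would denote the extended distance of metric spaces. *)
Local Notation edist := Defs.edist.

Section euclidean_distance.
Context {R : realType} {n : nat}.
Implicit Types (x y v : 'rV[R]_n) (U : set 'rV[R]_n).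

Lemma coord_le_edist x y i : `|x 0 i - y 0 i| <= edist x y.
Proof.
rewrite -sqrtr_sqr ler_wsqrtr// (bigD1 i)//= lerDl sumr_ge0// => j _.
exact: sqr_ge0.
Qed.

Lemma edist_le_coord x y (r : R) : 0 <= r ->
  (forall i, `|x 0 i - y 0 i| <= r) ->
  edist x y <= n%:R * r.
Proof.
move=> r0 xy; have nr0 : 0 <= n%:R * r by rewrite mulr_ge0.
rewrite -(ger0_norm nr0) -sqrtr_sqr ler_wsqrtr//.
apply: (@le_trans _ _ (\sum_(i < n) r ^+ 2)).
  by apply: ler_sum => i _; rewrite -real_normK ?num_real// ler_sqr// ?nnegrE.
rewrite sumr_const card_ord -[leLHS]mulr_natl exprMn ler_wpM2r ?sqr_ge0//.
by rewrite -natrX ler_nat -[leqLHS]muln1; case: n => // k; rewrite leq_pmul2l.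
Qed.

Lemma edist_affine (c : R) v x y : 0 <= c ->
  edist (c *: x + v) (c *: y + v) = c * edist x y.
Proof.
move=> c0; rewrite /edist -[in RHS](ger0_norm c0) -sqrtr_sqr -sqrtrM ?sqr_ge0//.
rewrite mulr_sumr; congr Num.sqrt; apply: eq_bigr => i _.
by rewrite !mxE opprD addrACA subrr addr0 -mulrBr exprMn.
Qed.

Lemma diam_ge0 U : (0 <= diam U)%E.
Proof. by apply: ereal_sup_ubound; left. Qed.

Lemma edist_le_diam U x y : U x -> U y -> ((edist x y)%:E <= diam U)%E.
Proof. by move=> Ux Uy; apply: ereal_sup_ubound; right; exists (x, y). Qed.

Lemma diam_le U (b : \bar R) : (0 <= b)%E ->
  (forall x y, U x -> U y -> ((edist x y)%:E <= b)%E) -> (diam U <= b)%E.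
Proof.
by move=> b0 h; apply: ge_ereal_sup => _ [->//|[[x y] [Ux Uy] <-]]; exact: h.
Qed.

Lemma continuous_edist_l y : continuous (edist ^~ y : 'rV[R]_n -> R).
Proof.
move=> x; rewrite /edist.
apply: (@continuous_comp _ _ _ (fun x => \sum_(i < n)
  (x 0 i - y 0 i) ^+ 2) Num.sqrt).
  apply: continuous_big => [|i _]; first exact: add_continuous.
  move=> z; apply: (@continuous_comp _ _ _
    (fun x : 'rV[R]_n => x 0 i - y 0 i) (fun r => r ^+ 2));
    last exact: exprn_continuous.
  exact: continuousB (@coord_continuous R 1 n 0 i z)
    (@cst_continuous _ _ (y 0 i) z).
exact: sqrt_continuous.
Qed.

Lemma edistC x y : edist x y = edist y x.
Proof.
by rewrite /edist; congr Num.sqrt; apply: eq_bigr => i _; rewrite -sqrrN opprB.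
Qed.

Lemma closure_edist_le U y (b : R) : (forall x, U x -> edist x y <= b) ->
  forall x, closure U x -> edist x y <= b.
Proof.
move=> h; suff : closure U `<=` [set x | edist x y <= b] by [].
rewrite closureE; apply: bigcap_inf; split=> //.
by apply: preimage_closed (@closed_le _ b) => x _; exact: continuous_edist_l.
Qed.

(** This lets covers be replaced by covers by closed, hence Lebesgue measurable,
    sets at no cost in Hausdorff measure. *)
Lemma diam_closure U : diam (closure U) = diam U.
Proof.
apply/eqP; rewrite eq_le; apply/andP; split; last first.
  apply: diam_le => [|x y Ux Uy]; first exact: diam_ge0.
  by apply: edist_le_diam; exact: subset_closure.
apply: diam_le => [|x y cx cy]; first exact: diam_ge0.
have [dfin|] := boolP (diam U \is a fin_num); last first.
  by rewrite ge0_fin_numE ?diam_ge0// -leNgt leye_eq => /eqP ->; rewrite leey.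
rewrite -(fineK dfin) lee_fin.
apply: (closure_edist_le _ cx) => {x cx}x Ux; rewrite edistC.
apply: (closure_edist_le _ cy) => {y cy}y Uy.
by rewrite -lee_fin fineK// edist_le_diam.
Qed.

Lemma diam_cube (a : 'rV[R]_n) r : 0 <= r ->
  (diam (box (cube a r)) <= (n%:R * r)%:E)%E.
Proof.
move=> r0; apply: diam_le => [|x y xa ya]; first by rewrite lee_fin mulr_ge0.
by rewrite lee_fin edist_le_coord// => i; exact/ltW/(cube_near i xa ya).
Qed.

End euclidean_distance.

(** * Hausdorff measure and Lipschitz maps *)

Section hausdorff_theory.
Context {R : realType} {n : nat}.
Implicit Types (A U : set 'rV[R]_n) (p d : R).

Let weight_ge0 p d U : [set U : set 'rV[R]_n | (diam U < d%:E)%E] U ->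
  (0 <= poweR (diam U) p)%E.
Proof. by move=> _; exact: poweR_ge0. Qed.

Lemma hausdorff_delta0 p d : hausdorff_delta p d (set0 : set 'rV[R]_n) = 0%E.
Proof. exact/cover_outer0/weight_ge0. Qed.

Lemma hausdorff_delta_ge0 p d A : (0 <= hausdorff_delta p d A)%E.
Proof. exact/cover_outer_ge0/weight_ge0. Qed.

Lemma hausdorff_delta_subadditive p d A F :
  subset_sigma_subadditive (hausdorff_delta p d) A F.
Proof. exact/cover_outer_subadditive/weight_ge0. Qed.

HB.instance Definition _ p d := isSubsetOuterMeasure.Build R 'rV[R]_n
  (hausdorff_delta p d) (hausdorff_delta0 p d) (hausdorff_delta_ge0 p d)
  (@hausdorff_delta_subadditive p d).

Lemma hausdorff_delta_le_diam p d U : (diam U < d%:E)%E ->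
  (hausdorff_delta p d U <= poweR (diam U) p)%E.
Proof.
move=> Ud; apply: ereal_inf_lbound; exists [set U]; last first.
  by rewrite esum_set1// poweR_ge0.
by split; [exact: countable1|move=> _ ->|move=> x Ux; exists U].
Qed.

Lemma hausdorff_delta_le p d A : 0 < d ->
  (hausdorff_delta p d A <= hausdorff p A)%E.
Proof.
move=> d0; rewrite hausdorffE; apply: ereal_sup_ubound; exists d => //=.
by rewrite in_itv/= d0.
Qed.

Lemma hausdorff_le p A (b : \bar R) :
  (forall d, 0 < d -> (hausdorff_delta p d A <= b)%E) -> (hausdorff p A <= b)%E.
Proof.
move=> h; rewrite hausdorffE; apply: ge_ereal_sup => _ [d + <-].
by rewrite /= in_itv/= andbT; exact: h.
Qed.

Lemma hausdorff_delta_anti p d1 d2 A : d1 <= d2 ->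
  (hausdorff_delta p d2 A <= hausdorff_delta p d1 A)%E.
Proof.
move=> d12; apply: ereal_inf_le_tmp => _ [F [cF Fd AF] <-]; exists F => //;
  split => // U /Fd /=.
by move=> /lt_le_trans; apply; rewrite lee_fin.
Qed.

Lemma le_poweR (x y : \bar R) p : 0 <= p -> (0 <= x)%E -> (x <= y)%E ->
  (poweR x p <= poweR y p)%E.
Proof.
move=> p0 x0 xy; apply: gt0_ler_poweR => //; rewrite in_itv/= leey andbT//.
exact: le_trans xy.
Qed.

End hausdorff_theory.

Section lipschitz.
Context {R : realType} {n : nat}.
Variables (p c : R) (phi : 'rV[R]_n -> 'rV[R]_n).
Hypotheses (p0 : 0 <= p) (c0 : 0 < c).
Hypothesis phi_lip : forall x y, edist (phi x) (phi y) <= c * edist x y.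

Lemma diam_image_le U : (diam (phi @` U) <= c%:E * diam U)%E.
Proof.
apply: diam_le => [|_ _ [x Ux <-] [y Uy <-]].
  by rewrite mule_ge0 ?diam_ge0// lee_fin ltW.
apply: (@le_trans _ _ (c%:E * (edist x y)%:E)%E); first by rewrite lee_fin.
by rewrite lee_wpmul2l ?edist_le_diam// lee_fin ltW.
Qed.

Lemma hausdorff_lipschitz A :
  (hausdorff p (phi @` A) <= (c `^ p)%:E * hausdorff p A)%E.
Proof.
apply: hausdorff_le => d d0.
apply: (@le_trans _ _ ((c `^ p)%:E * hausdorff_delta p (d / c) A)%E);
  last first.
  by rewrite lee_wpmul2l ?lee_fin ?powR_ge0// hausdorff_delta_le// divr_gt0.
apply: (@le_cover_outer _ _ _ (fun X => hausdorff_delta p d (phi @` X))) => //.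
- by rewrite image_set0 outer_measure0.
- by move=> X; exact: outer_measure_ge0.
- move=> X G XG; apply: hausdorff_delta_subadditive => _ [x /XG[k _ Gx] <-].
  by exists k => //; exists x.
- exact: powR_gt0.
move=> U /= Ud.
have cU : (c%:E * diam U < d%:E)%E.
  by rewrite -lte_pdivlMl// -EFinM mulrC.
apply: le_trans (hausdorff_delta_le_diam _ (le_lt_trans
  (diam_image_le U) cU)) _.
rewrite -poweR_EFin -poweRM ?diam_ge0 ?lee_fin//; last exact: ltW.
by apply: le_poweR; rewrite ?diam_ge0 ?diam_image_le.
Qed.

End lipschitz.

Section top_dimension.
Context {R : realType} {n : nat}.
Notation leb := (@lebesgue_outer R n).
Notation haus := (@hausdorff R n n%:R).
Implicit Types (A U : set 'rV[R]_n).

Lemma hausdorff_affine (c : R) (v : 'rV[R]_n) A : 0 < c ->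
  haus [set c *: x + v | x in A] = ((c ^+ n)%:E * haus A)%E.
Proof.
have le (c' : R) (v' : 'rV[R]_n) A' : 0 < c' ->
    (haus ([set (c' *: x + v')%R | x in A']) <= (c' ^+ n)%:E * haus A')%E.
  move=> c0; rewrite -powR_mulrn; last exact: ltW.
  apply: hausdorff_lipschitz => // x y.
  by rewrite edist_affine ?lexx// ltW.
move=> c0; apply/eqP; rewrite eq_le le//= -lee_pdivlMl ?exprn_gt0//.
rewrite -exprVn; apply: le_trans (le c^-1 (- (c^-1 *: v)) _ _);
  last by rewrite invr_gt0.
apply: le_outer_measure => x Ax; exists (c *: x + v); first by exists x.
by rewrite scalerDr addrK scalerA mulVf ?scale1r// gt_eqF.
Qed.

Lemma image_cube (c : R) (a : 'rV[R]_n) : 0 < c ->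
  [set c *: x + a | x in box (cube 0 1)] = box (cube a c).
Proof.
move=> c0; apply/seteqP; split=> [_ [x x01 <-] i|x xac].
  have := x01 i; rewrite !mxE add0r => /andP[x0 x1].
  by rewrite -subr_gt0 addrK mulr_gt0//= addrC lerD2l ger_pMr.
exists (c^-1 *: (x - a)).
  move=> i; have := xac i; rewrite !mxE add0r => /andP[ax xa].
  by rewrite mulr_gt0 ?invr_gt0 ?subr_gt0//= ler_pdivrMl// mulr1 lerBlDl.
by rewrite scalerA divff ?gt_eqF// scale1r subrK.
Qed.

Lemma hausdorff_cube (a : 'rV[R]_n) (r : R) : 0 < r ->
  haus (box (cube a r)) = ((r ^+ n)%:E * haus (box (cube 0 1)))%E.
Proof. by move=> r0; rewrite -image_cube// hausdorff_affine. Qed.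

(** Cubes of side r have diameter at most n r. The constant n^n is not sharp; it
    serves to show that H^n is finite on cubes, and that the ratio to the volume
    is at most 1 in dimension 0. *)
Lemma hausdorff_box_le_nat ab : box_bounds ab ->
  (haus (box ab) <= (n%:R ^+ n)%:E * box_volume ab)%E.
Proof.
move=> Cab; apply: hausdorff_le => d d0.
apply: (@le_outer_measure_box _ _ _ _ (d / n.+1%:R)) => //.
- by rewrite divr_gt0.
move=> r a /andP[r0 rd].
have nrd : (diam (box (cube a r)) < d%:E)%E.
  apply: (@le_lt_trans _ _ (n%:R * r)%:E); first exact/diam_cube/ltW.
  rewrite lte_fin; move: rd; rewrite ltr_pdivlMr// mulrC; apply: le_lt_trans.
  by rewrite ler_wpM2r ?ler_nat// ltW.
apply: le_trans (hausdorff_delta_le_diam _ nrd) _.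
apply: (@le_trans _ _ (poweR (n%:R * r)%:E n%:R)).
  by rewrite le_poweR ?diam_ge0 ?diam_cube// ltW.
by rewrite poweR_EFin powR_mulrn ?exprMn// mulr_ge0// ltW.
Qed.

(** A nonempty set of diameter r lies in the cube of side 2 (r + e) around any
    of its points, for each e > 0. The margin e is there because boxes are open
    on the left and because r may be 0. *)
Lemma lebesgue_outer_le_diam U : (diam U < +oo)%E ->
  (leb U <= (2 ^+ n)%:E * poweR (diam U) n%:R)%E.
Proof.
move=> Ufin; have Uf : diam U \is a fin_num by rewrite ge0_fin_numE ?diam_ge0.
have [->|/set0P[x Ux]] := eqVneq U set0.
  by rewrite outer_measure0 mule_ge0// poweR_ge0.
pose r := fine (diam U).
have r0 : 0 <= r by rewrite fine_ge0// diam_ge0.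
rewrite -(fineK Uf) poweR_EFin powR_mulrn// -EFinM -exprMn.
pose c e : 'rV[R]_n * 'rV[R]_n := cube (x - const_mx (r + e)) (2 * (r + e)).
have Uc e : 0 < e -> (leb U <= ((2 * (r + e)) ^+ n)%:E)%E.
  move=> e0; rewrite -(cube_volume (x - const_mx (r + e))).
  apply: le_trans (lebesgue_outer_box_le (cube_bounds _ _)); last first.
    by rewrite mulr_ge0// addr_ge0// ltW.
  apply: le_outer_measure => y Uy i; rewrite !mxE.
  have : `|x 0 i - y 0 i| <= r.
    apply: le_trans (coord_le_edist x y i) _.
    by rewrite -lee_fin fineK// edist_le_diam.
  by rewrite ler_norml => /andP[? ?]; apply/andP; split; lra.
have leU : leb U \is a fin_num.
  by rewrite ge0_fin_numE ?outer_measure_ge0// (le_lt_trans (Uc 1 _))// ltry.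
rewrite -(fineK leU) lee_fin.
apply: (@cvgr_to_ge _ (0^'+) _ _ (fun e => (2 * (r + e)) ^+ n)).
  rewrite -[fine (diam U)]addr0; apply: cvg_at_right_filter.
  apply: (@continuous_comp _ _ _ (fun e => 2 * (r + e)) (fun z => z ^+ n));
    last exact: exprn_continuous.
  by apply: cvgMr; apply: cvgD; [exact: cvg_cst|exact: cvg_id].
by near=> e; rewrite -lee_fin fineK// Uc.
Unshelve. all: by end_near. Qed.

Lemma lebesgue_outer_le_hausdorff A : (leb A <= (2 ^+ n)%:E * haus A)%E.
Proof.
apply: (@le_trans _ _ ((2 ^+ n)%:E * hausdorff_delta n%:R 1 A)%E); last first.
  by rewrite lee_wpmul2l// hausdorff_delta_le.
apply: le_cover_outer => //.
- exact: lebesgue_outer_ge0.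
- exact: lebesgue_outer_subadditive.
by move=> U /= U1; apply: lebesgue_outer_le_diam; apply: lt_trans U1 _;
  exact: ltry.
Qed.

End top_dimension.

(** * Proportionality of the Hausdorff and Lebesgue measures *)

Lemma caratheodory_nondecreasing_cvg {R : realType} {T : pointedType}
    (mu : {outer_measure set T -> \bar R}) (F : (set T)^nat) :
  (forall i, mu.-caratheodory (F i)) ->
  (forall i j, (i <= j)%N -> F i `<=` F j) ->
  mu (F i) @[i --> \oo] --> mu (\bigcup_i F i).
Proof.
move=> mF ndF.
apply: (@nondecreasing_cvg_mu _ (caratheodory_type mu) R mu F) => //.
  exact: caratheodory_measurable_bigcup.
by move=> i j ij; apply/subsetPset; exact: ndF.
Qed.

Section proportionality.
Context {R : realType} {n : nat}.
Notation leb := (@lebesgue_outer R n).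
Notation haus := (@hausdorff R n n%:R).
Implicit Types (A B : set 'rV[R]_n).

(** For each k take a cover of A by sets of diameter below 1/(k+1) which is
    optimal up to 1/(k+1), and replace its members by their closures; the
    intersection over k of the unions of these covers is a Borel hull of A. *)
Lemma hausdorff_lebesgue_hull (p : R) A :
  exists B, [/\ A `<=` B,
    leb.-caratheodory B & (hausdorff p B <= hausdorff p A)%E].
Proof.
have [HA|] := boolP (hausdorff p A \is a fin_num); last first.
  rewrite ge0_fin_numE ?outer_measure_ge0// -leNgt leye_eq => /eqP ->.
  exists setT; split => //; last by rewrite leey.
  by rewrite -setC0; exact/caratheodory_measurable_setC/caratheodory_measurable_set0.
pose e k : R := k.+1%:R^-1.
have e0 k : 0 < e k by rewrite invr_gt0 ltr0n.
pose P k (F : set (set 'rV[R]_n)) :=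
  countable_cover id [set U : set 'rV[R]_n | (diam U < (e k)%:E)%E] A F /\
  (\esum_(U in F) poweR (diam U) p <= hausdorff p A + (e k)%:E)%E.
have [F PF] : {F : nat -> set (set 'rV[R]_n) & forall k, P k (F k)}.
  apply: (@choice _ _ P) => k.
  have Hk : hausdorff_delta p (e k) A \is a fin_num.
    rewrite ge0_fin_numE ?outer_measure_ge0//.
    apply: le_lt_trans (hausdorff_delta_le p A (e0 k)) _.
    by rewrite -ge0_fin_numE ?outer_measure_ge0.
  have [_ [B cB <-] ltB] := lb_ereal_inf_adherent (e0 k) Hk.
  exists B; split => //; apply: le_trans (ltW ltB) _.
  by rewrite leeD2r// hausdorff_delta_le.
pose B k := \bigcup_(U in F k) closure U.
have mB k : leb.-caratheodory (B k).
  have [[/countable_injP[g ginj] _ _] _] := PF k.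
  rewrite (_ : B k = \bigcup_i \bigcup_(U in F k `&` g @^-1` [set i]) closure
    U).
    apply: caratheodory_measurable_bigcup => i.
    have [[U [FU gU]]|no] := pselect (exists U, (F k `&` g @^-1` [set i]) U).
      rewrite (_ : \bigcup_(_ in _) _ = closure U).
        rewrite -[closure U]setCK; apply: caratheodory_measurable_setC.
        by apply: open_measurable_lebesgue_outer; apply: closed_openC;
          exact: closed_closure.
      apply/seteqP; split=> [x [V [FV gV] Vx]|x Ux]; last by exists U.
      by rewrite -(ginj V U) ?inE// gV gU.
    rewrite (_ : \bigcup_(_ in _) _ = set0);
      first exact: caratheodory_measurable_set0.
    by rewrite -subset0 => x [V FgV _]; apply: no; exists V.
  apply/seteqP; split=> [x [U FU Ux]|x [i _ [U [FU _] Ux]]]; last by exists U.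
  by exists (g U) => //; exists U.
exists (\bigcap_k B k); split.
- move=> x Ax k _; have [[_ _ /(_ _ Ax)[U FU Ux]] _] := PF k.
  by exists U => //; exact: subset_closure.
- by apply: (@bigcapT_measurable _ (caratheodory_type leb)) => k; exact: mB.
apply: hausdorff_le => d d0; apply/lee_addgt0Pr => t t0.
near \oo => k.
have ekd : e k < d by near: k; exact: (near_infty_natSinv_lt (PosNum d0)).
have ekt : e k < t by near: k; exact: (near_infty_natSinv_lt (PosNum t0)).
have [[cF Fd _] Fle] := PF k.
apply: le_trans (hausdorff_delta_anti _ _ (ltW ekd)) _.
apply: (@le_trans _ _ (hausdorff p A + (e k)%:E)%E); last first.
  by rewrite leeD2l// lee_fin ltW.
apply: le_trans Fle.
apply: (@le_trans _ _ (\esum_(U in F k) hausdorff_delta p (e k) (closure U))).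
  apply: (@subset_subadditive_esum _ _ _ (hausdorff_delta p
    (e k)) closure) => //.
  - exact: hausdorff_delta_ge0.
  - exact: hausdorff_delta_subadditive.
  - by move=> x /(_ k I).
apply: le_esum => U FU; rewrite -(diam_closure U).
apply: hausdorff_delta_le_diam; rewrite diam_closure; exact: Fd.
Unshelve. all: by end_near. Qed.

(** The constant k such that H^n = k L. *)
Definition cube_ratio : R := fine (haus (box (cube 0 1))).
Notation k := cube_ratio.

Lemma cube_ratio_ge0 : 0 <= k.
Proof. by rewrite fine_ge0// hausdorff_ge0. Qed.

Lemma hausdorff_cube_le_nat (a : 'rV[R]_n) (r : R) : 0 <= r ->
  (haus (box (cube a r)) <= (n%:R ^+ n * r ^+ n)%:E)%E.
Proof.
by move=> r0; rewrite EFinM -(cube_volume a r);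
  exact/hausdorff_box_le_nat/cube_bounds.
Qed.

Lemma hausdorff_cubeE (a : 'rV[R]_n) (r : R) : 0 < r ->
  haus (box (cube a r)) = (k * r ^+ n)%:E.
Proof.
move=> r0; rewrite hausdorff_cube// [in RHS]mulrC EFinM fineK//.
rewrite ge0_fin_numE ?hausdorff_ge0//.
by apply: le_lt_trans (hausdorff_cube_le_nat _ ler01) _; exact: ltry.
Qed.

(** Stated for every positive c above the ratio, and not for the ratio itself,
    as it is used to show that the ratio is positive. *)
Lemma hausdorff_le_lebesgue (c : R) A : 0 < c -> k <= c ->
  (haus A <= c%:E * leb A)%E.
Proof.
move=> c0 kc; apply: le_lebesgue_outer => //.
- exact: hausdorff_ge0.
- exact: hausdorff_subadditive.
move=> ab Cab; apply: (@le_outer_measure_box _ _ _ _ 1) => //; first exact: ltW.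
move=> r a /andP[r0 _]; apply: (@le_trans _ _ (k * r ^+ n)%:E).
  by rewrite -(hausdorff_cubeE a r0).
by rewrite lee_fin ler_wpM2r// exprn_ge0// ltW.
Qed.

(** The ratio is bounded from below by comparing both measures on such a D. *)
Hypothesis nontrivial : exists D, (0 < leb D < +oo)%E.

(** If the ratio were 0, then H^n <= c L for arbitrarily small c, against
    L <= 2^n H^n on a set of finite positive measure. *)
Lemma cube_ratio_gt0 : 0 < k.
Proof.
rewrite lt_neqAle cube_ratio_ge0 andbT; apply/eqP => k0.
have [D /andP[D0 Doo]] := nontrivial.
(* A constant small enough for 2^n c < 1. *)
pose c : R := (2 ^+ n)^-1 / 2.
have c0 : 0 < c by rewrite divr_gt0// invr_gt0 exprn_gt0.
have Df : leb D \is a fin_num by rewrite ge0_fin_numE// outer_measure_ge0.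
have : (leb D <= (2 ^+ n)%:E * (c%:E * leb D))%E.
  apply: le_trans (lebesgue_outer_le_hausdorff D) _.
  by rewrite lee_wpmul2l// hausdorff_le_lebesgue// -k0 ltW.
apply/negP; rewrite -ltNge muleA -EFinM mulrA divff ?gt_eqF ?exprn_gt0// mul1r.
rewrite -(fineK Df) -EFinM lte_fin; move: D0; rewrite -(fineK Df) lte_fin => D0.
by rewrite gtr_pMl// invf_lt1// ltr1n.
Qed.

Let kD : (0 < k)%R := cube_ratio_gt0.

(** In a cube Q of side r, k L(B) + k L(Q - B) = k L(Q) <= k r^n = H^n(Q), while
    H^n(Q) <= H^n(B) + H^n(Q - B) <= H^n(B) + k L(Q - B). *)
Lemma lebesgue_le_hausdorff_cube (a : 'rV[R]_n) (r : R) B : 0 < r ->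
  leb.-caratheodory B -> B `<=` box (cube a r) ->
  (k%:E * leb B <= haus B)%E.
Proof.
move=> r0 mB BQ; pose Q := box (cube a r).
have Qle : (leb Q <= (r ^+ n)%:E)%E.
  by rewrite -(cube_volume a); apply: lebesgue_outer_box_le;
    exact/cube_bounds/ltW.
have fin X : X `<=` Q -> leb X \is a fin_num.
  move=> XQ; rewrite ge0_fin_numE ?outer_measure_ge0//.
  by apply: le_lt_trans (le_outer_measure leb _ _ XQ) (le_lt_trans Qle _);
    exact: ltry.
have fQB : leb (Q `\` B) \is a fin_num by apply: fin; exact: subIsetl.
have QB : leb Q = (leb B + leb (Q `\` B))%E by
  rewrite (mB Q) (setIidr BQ) setDE.
rewrite -(@leeD2rE _ (k%:E * leb (Q `\` B))%E); last by rewrite fin_numM.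
rewrite -ge0_muleDr ?outer_measure_ge0// -QB.
apply: (@le_trans _ _ (haus Q)).
  by rewrite hausdorff_cubeE// EFinM lee_wpmul2l// lee_fin ltW.
apply: (@le_trans _ _ (haus B + haus (Q `\` B))%E); last first.
  by rewrite leeD2l// hausdorff_le_lebesgue.
rewrite (_ : haus Q = haus (B `|` (Q `\` B))); last by rewrite setDUK.
exact: outer_measureU2.
Qed.

Lemma lebesgue_le_hausdorff_measurable B : leb.-caratheodory B ->
  (k%:E * leb B <= haus B)%E.
Proof.
move=> mB; rewrite -lee_pdivlMl//.
pose Q j := box (cube (- const_mx j%:R : 'rV[R]_n) (2 * j%:R)).
have QE j : Q j = [set x : 'rV[R]_n | forall i, - j%:R < x 0 i <= j%:R].
  apply/seteqP; split=> x h i; have := h i; rewrite !mxE => /andP[? ?];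
    by apply/andP; split; lra.
have BE : B = \bigcup_j (B `&` Q j).
  rewrite -setI_bigcupr; apply/esym/setIidl => x _.
  near \oo => j; exists j => //; rewrite QE => i.
  have : `|x 0 i| < j%:R.
    apply: le_lt_trans (_ : \sum_i `|x 0 i| < _).
      by rewrite (bigD1 i)//= lerDl sumr_ge0.
    by near: j; exact: nbhs_infty_gtr.
  by rewrite ltr_norml => /andP[-> /ltW ->].
have mBQ j : leb.-caratheodory (B `&` Q j).
  by apply: caratheodory_measurable_setI => //; exact: box_measurable.
have cvg : (leb \o (fun j => B `&` Q j)) x @[x --> \oo] --> leb B.
  rewrite [in X in _ --> X]BE.
  apply: caratheodory_nondecreasing_cvg => //.
  move=> i j ij; apply: setIS => x; rewrite !QE => h l.
  have ij' : i%:R <= j%:R :> R by rewrite ler_nat.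
  by have /andP[? ?] := h l; apply/andP; split; lra.
rewrite -(cvg_lim _ cvg)//; apply: lime_le; first by apply/cvg_ex;
  exists (leb B).
near=> j; rewrite /= lee_pdivlMl//.
apply: (@le_trans _ _ (haus (B `&` Q j)));
  last by apply: le_outer_measure; exact: subIsetl.
apply: (@lebesgue_le_hausdorff_cube (- const_mx j%:R) (2 * j%:R)) => //.
  by rewrite mulr_gt0// ltr0n; near: j; exact: nbhs_infty_gt.
Unshelve. all: by end_near. Qed.

Lemma hausdorff_proportional A : haus A = (k%:E * leb A)%E.
Proof.
apply/eqP; rewrite eq_le hausdorff_le_lebesgue//=.
have [B [AB mB HB]] := hausdorff_lebesgue_hull n%:R A.
apply: le_trans HB; apply: le_trans (lebesgue_le_hausdorff_measurable mB).
by rewrite lee_wpmul2l ?lee_fin ?cube_ratio_ge0// le_outer_measure.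
Qed.

(** H^n is multiplied by c^n under the dilation of ratio c, so c = k^(-1/n)
    absorbs the constant k. *)
Lemma hausdorff_scaled_eq_lebesgue :
  exists2 c : R, 0 < c & forall A, haus [set c *: x | x in A] = leb A.
Proof.
have [c c0 cn] : exists2 c : R, 0 < c & c ^+ n * k = 1.
  have [n0|n0] := eqVneq n 0%N.
    (* Dilations preserve H^0, so k = 1 is needed: k <= n^n = 1, and k >= 1
       since L <= 2^0 H^0 = k L. *)
    have [D /andP[D0 Doo]] := nontrivial.
    have Df : leb D \is a fin_num by rewrite ge0_fin_numE// outer_measure_ge0.
    exists 1; rewrite ?ltr01// expr1n mul1r.
    apply/eqP; rewrite eq_le; apply/andP; split.
      rewrite -lee_fin; have := hausdorff_cube_le_nat 0 ler01.
      by rewrite hausdorff_cubeE// n0 !expr0 !mulr1.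
    have := lebesgue_outer_le_hausdorff D.
    rewrite (_ : 2 ^+ n = 1 :> R) ?mul1e; last by rewrite n0 expr0.
    rewrite hausdorff_proportional -(fineK Df) -EFinM lee_fin.
    by rewrite ler_pMl// -lte_fin fineK.
  exists (k `^ (- n%:R^-1)); first exact: powR_gt0.
  rewrite -powR_mulrn ?powR_ge0// -powRrM mulNr mulVf ?pnatr_eq0//.
  by rewrite powRN powRr1 ?cube_ratio_ge0// mulVf// gt_eqF.
exists c => // A; have := hausdorff_affine 0 A c0.
rewrite (_ : (fun x => _) = (fun x => c *: x));
  last by apply/funext => x; rewrite addr0.
by move=> ->; rewrite hausdorff_proportional muleA -EFinM cn mul1e.
Qed.

End proportionality.

(** * Transport of measurability *)

(** Caratheodory measurability is tested against all sets, so the two outer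
    measures have to correspond on all sets. *)
Lemma caratheodory_image {R : realType} {T T' : Type}
    (mu : {outer_measure set T -> \bar R}) (nu : {outer_measure set T' ->
      \bar R})
    (g : T -> T') (g' : T' -> T) (A : set T) :
  cancel g g' -> cancel g' g -> (forall X, nu (g @` X) = mu X) ->
  nu.-caratheodory (g @` A) <-> mu.-caratheodory A.
Proof.
move=> gK g'K nug.
have gI X : g @` (X `&` A) = g @` X `&` g @` A.
  apply/seteqP; split=> [_ [x [Xx Ax] <-]|_ [[x Xx <-] [y Ay /(can_inj gK)
    yx]]].
    by split; exists x.
  by exists x => //; split=> //; rewrite -yx.
have gD X : g @` (X `&` ~` A) = g @` X `&` ~` (g @` A).
  apply/seteqP; split=> [_ [x [Xx nAx] <-]|_ [[x Xx <-] nA]].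
    by split; [exists x|move=> [y Ay /(can_inj gK) yx]; apply: nAx;
      rewrite -yx].
  by exists x => //; split=> // Ax; apply: nA; exists x.
have gX (X : set T') : X = g @` (g' @` X).
  by rewrite image_comp (_ : g \o g' = id) ?image_id//; apply/funext.
split=> h X; first by rewrite -!nug gI gD; exact: h.
by rewrite (gX X) -gI -gD !nug; exact: h.
Qed.

(** * Approximation of measurable sets by finite unions of boxes *)

Section box_approximation.
Context {R : realType} {n : nat}.
Notation leb := (@lebesgue_outer R n).

(** Take a cover of A by boxes of total volume below L(A) + e, and keep finitely
    many boxes so that the discarded ones have total volume below e. *)
Lemma finite_box_approximation (A : set 'rV[R]_n) (e : R) :
  leb.-caratheodory A -> (leb A < +oo)%E -> 0 < e ->
  exists s : seq ('rV[R]_n * 'rV[R]_n),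
    (leb (A `\` \bigcup_(ab in [set` s]) box ab) <= e%:E)%E /\
    (leb (\bigcup_(ab in [set` s]) box ab `\` A) <= e%:E)%E.
Proof.
move=> mA Aoo e0.
have Af : leb A \is a fin_num by rewrite ge0_fin_numE ?outer_measure_ge0.
have [_ [F [cF FC AF] <-] ltF] := lb_ereal_inf_adherent e0 Af.
have vol0 ab : F ab -> (0 <= box_volume ab)%E by move=> /FC;
  exact: box_volume_ge0.
have boxes G : G `<=` F ->
  (leb (\bigcup_(ab in G) box ab) <= \esum_(ab in G) box_volume ab)%E.
  move=> GF; apply: (@le_trans _ _ (\esum_(ab in G) leb (box ab))%E).
    apply: subset_subadditive_esum => //.
    - exact: lebesgue_outer_ge0.
    - exact: lebesgue_outer_subadditive.
    - by apply: sub_countable cF; exact: subset_card_le.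
  by apply: le_esum => ab /GF /FC; exact: lebesgue_outer_box_le.
have Ff : (\esum_(ab in F) box_volume ab \is a fin_num)%E.
  rewrite ge0_fin_numE ?esum_ge0//; apply: lt_le_trans ltF _.
  by rewrite leey.
have [_ [X [finX XF] <-] ltX] := ub_ereal_sup_adherent e0 Ff.
have [s sX] : exists s : seq ('rV[R]_n * 'rV[R]_n), X = [set` s] by
  exact/finite_seqP.
exists s; rewrite -sX; split.
  apply: (@le_trans _ _ (\esum_(ab in F `&` ~` X) box_volume ab)%E).
    apply: le_trans (boxes _ _); last exact: subIsetl.
    apply: le_outer_measure => x [/AF[ab Fab abx] nX].
    by exists ab => //; split=> // Xab; apply: nX; exists ab.
  rewrite -/(esum F box_volume) in ltX.
  move: ltX Ff; rewrite (esumID X)// (setIidr XF).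
  rewrite (esum_fset finX) => [|ab]; last by rewrite inE => /XF /vol0.
  set a := \sum_(_ \in _) _; set b := (\esum_(_ in _) _)%E.
  rewrite [in X in _ -> X -> _]fin_numD => + /andP[af bf].
  rewrite -(fineK af) -(fineK bf) -EFinN -!EFinD lte_fin lee_fin => ?; lra.
pose V := \bigcup_(ab in F) box ab.
apply: (@le_trans _ _ (leb (V `\` A))).
  by apply: le_outer_measure => x [[ab /XF Fab abx] nA]; split=> //; exists ab.
have : (leb A + leb (V `\` A) <= leb A + e%:E)%E.
  by rewrite -[X in (leb X + _)%E](setIidr AF) setDE -mA (le_trans
    (boxes _ _))// ltW.
by rewrite leeD2lE.
Qed.

End box_approximation.

(** * Functions determined by the signs of affine forms *)

Section one_vertex_graph.
Context {R : realType} {n : nat}.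

Definition affine_form (q : 'rV[R]_n * R) (x : 'rV[R]_n) : R :=
  \sum_i x 0 i * q.1 0 i + q.2.

(** The description by agreement of signs, rather than by a function of the sign
    vector, is stable under composition without bookkeeping of indices. *)
Definition sign_determined (T : Type) (h : 'rV[R]_n -> T) :=
  exists s : seq ('rV[R]_n * R), forall x y,
    (forall q, q \in s -> (0 <= affine_form q x) = (0 <= affine_form q y)) ->
    h x = h y.

(** The vertices of the graph are [None], the source, and [Some t] for each
    target t; there is one arrow from [None] for each sign pattern realized by
    some point x, leading to [Some (h x)]. *)
Lemma sign_determined_linear_logical (T : finType) (h : 'rV[R]_n -> T) D :
  sign_determined h -> (forall t, exists x, h x = t) -> linear_logical D h.
Proof.
move=> [s hs] hsurj.
pose k := size s.
pose q (j : 'I_k) := nth (0, 0) s j.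
pose l (x : 'rV[R]_n) : 'rV[R]_k := \row_j affine_form (q j) x.
pose sg x : {ffun 'I_k -> bool} := [ffun j => 0 <= l x 0 j].
have sgh x y : sg x = sg y -> h x = h y.
  move=> xy; apply: hs => p /(nthP (0, 0))[j js <-].
  by have := congr1 (fun f : {ffun _ -> _} => f (Ordinal js)) xy;
    rewrite !ffunE !mxE.
have laff : affine_map l.
  exists (\matrix_(i, j) (q j).1 0 i), (\row_j (q j).2) => x.
  apply/rowP => j; rewrite !mxE; congr (_ + _).
  by apply: eq_bigr => i _; rewrite !mxE.
pose arrow := {sigma : {ffun 'I_k -> bool} | `[< exists x, sg x = sigma >]}.
have witP (a : arrow) : exists x, sg x = val a by apply/asboolP;
  exact: (valP a).
pose wit a := projT1 (cid (witP a)).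
have witE a : sg (wit a) = val a by exact: (projT2 (cid (witP a))).
have sgP x : `[< exists y, sg y = sg x >] by apply/asboolP; exists x.
pose arr x : arrow := Sub (sg x) (sgP x).
have h_arr x : h (wit (arr x)) = h x by apply: sgh; rewrite witE.
pose src (a : arrow) : option T := None.
pose tgt (a : arrow) : option T := Some (h (wit a)).
pose label (v : option T) : T := if v is Some t then t else h 0.
pose chamber (a : arrow) := [set x : 'rV[R]_n | sg x = val a].
have acyclic (c : seq (option T)) :
    cycle (fun u v => [exists a, (src a == u) && (tgt a == v)]) c -> c = [::].
  case: c => // u p /=; rewrite rcons_path => /andP[+ /existsP[a /andP[/eqP au
    /eqP ua]]].
  case: p au => [/=|v p _ /= /andP[/existsP[b /andP[/eqP ub _]] _]].
    by rewrite -ua.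
  by move: ub; rewrite -ua.
have sourceP v : v = None <-> forall a, tgt a <> v.
  split=> [->//|]; case: v => // t no; exfalso.
  by have [x xt] := hsurj t; apply: (no (arr x)); rewrite /tgt h_arr xt.
pose out (v : option T) := [pred a : arrow | src a == v].
have out_None : #|out None| = #|{: arrow}| by apply: eq_card => a;
  rewrite inE eqxx.
have out_Some t : #|out (Some t)| = 0%N by apply: eq_card0.
have out_gt0 : (0 < #|out None|)%N by rewrite out_None; apply/card_gt0P;
  exists (arr 0).
have targetP : set_bij [set v | #|out v| = 0%N] [set: T] label.
  split=> // [[t|] [t'|]|t _]; rewrite ?inE /=.
  - by move=> _ _ ->.
  - by move=> _ /eqP; rewrite -leqn0 leqNgt out_gt0.
  - by move=> /eqP; rewrite -leqn0 leqNgt out_gt0.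
  - by [].
  - by exists (Some t) => //=; exact: out_Some.
have chamberP v : (1 < #|out v|)%N ->
  set_bij [set a | src a = v] (chambers l) chamber.
  move=> v1; have {v1}-> : v = None by case: v v1 => // t; rewrite out_Some.
  have signE x (a : arrow) : (sg x = val a) <->
    (forall i, (0 <= l x 0 i) = val a i).
    split=> [<- i|xa]; first by rewrite ffunE.
    by apply/ffunP => i; rewrite ffunE.
  split=> [a _|a b _ _ ab|C [[x Cx] [sigma CE]]].
  - split; first by exists (wit a); exact: witE.
    by exists (val a); apply/seteqP; split=> x /signE.
  - apply: val_inj; rewrite -(witE a).
    by have : chamber a (wit a) by [exact: witE]; rewrite ab.
  exists (arr x) => //; rewrite CE /chamber; apply/seteqP; split=> y.
    move=> /signE yx i; rewrite yx ffunE.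
    by move: Cx; rewrite CE => ->.
  move=> ysigma; apply/ffunP => i; rewrite !ffunE ysigma.
  by move: Cx; rewrite CE => ->.
pose G := @LinearLogicalGraph R n T (option T) arrow src tgt None label
  (fun=> k) (fun=> l) chamber acyclic sourceP targetP
    (fun _ _ => laff) chamberP.
exists G => x _; rewrite /llg_fun.
have nextS t : llg_next (G := G) x (Some t) = Some t.
  by rewrite /llg_next; case: pickP.
have next0 : llg_next (G := G) x None = Some (h x).
  rewrite /llg_next; case: pickP => [a /andP[_ /asboolP xa]|/(_ (arr x))].
    congr Some; apply: sgh; rewrite witE.
    have [a1|] := ltnP 1 #|{: arrow}|.
      by rewrite (_ : sg x = val a)//; apply: xa;
        rewrite /= [X in (_ < X)%N]out_None.
    move=> /card_le1P /(_ (arr x)); rewrite inE => /(_ isT a).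
    by rewrite !inE => /esym/eqP ->.
  rewrite inE /=; move/negP; case; apply/asboolP => _; exact: erefl.
rewrite card_option iterSr next0.
by rewrite (_ : iter _ _ _ = Some (h x))//; elim: #|T| => //= m ->.
Qed.

End one_vertex_graph.

Lemma sign_determined_scale {R : realType} {n : nat} (T : Type)
    (h : 'rV[R]_n -> T) (c : R) :
  sign_determined h -> sign_determined (fun x => h (c *: x)).
Proof.
move=> [s hs]; exists [seq (c *: q.1, q.2) | q <- s] => x y xy.
have aff q z : affine_form q (c *: z) = affine_form (c *: q.1, q.2) z.
  by congr (_ + _); apply: eq_bigr => i _; rewrite !mxE mulrCA mulrA.
by apply: hs => q qs; rewrite !aff; apply: xy; exact: map_f.
Qed.

(** * Charts over subsets of a graph *)

(** The topology of a graph only sees the level sets of the function, so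
    changing the labels of the values does not affect continuity. *)
Lemma factor_discrete_continuous (S : topologicalType) (T T' : choiceType)
    (g : S -> discrete_topology T) (h : S -> discrete_topology T') :
  continuous g -> (forall u v, g u = g v -> h u = h v) -> continuous h.
Proof.
move=> cg gh u A /nbhs_singleton Ah; rewrite nbhs_filterE /=.
have : nbhs u (g @^-1` [set g u]) by apply: cg; exact: discrete_set1.
by apply: filterS => v /= /gh ->.
Qed.

Lemma set_type_continuous (S X : topologicalType) (A : set X) (g : S -> A) :
  continuous (fun s => \val (g s)) -> continuous g.
Proof.
move=> cg s V [_ [[B oB <-] Bgs BV]].
have : nbhs s ((fun s => \val (g s)) @^-1` B) by apply: cg;
  exact: open_nbhs_nbhs.
by apply: filterS => t Bt; exact: BV.
Qed.

Section graph_chart.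
Context {R : realType} {n : nat} {T T' : finType}.
Notation leb := (@lebesgue_outer R n).
Notation haus := (@hausdorff R n n%:R).
Variables (D : set 'rV[R]_n) (mD : leb.-caratheodory D) (f : 'rV[R]_n -> T).
Variables (U : set 'rV[R]_n) (h : 'rV[R]_n -> T').
Hypotheses (mU : leb.-caratheodory U) (UD : U `<=` D) (U0 : (0 < leb U)%E).
(** On U the functions f and h have the same level sets, so their graphs over U
    are homeomorphic although f and h may take values in different sets. *)
Hypothesis fh : forall x y, U x -> U y -> (f x = f y <-> h x = h y).
Variable c : R.
Hypotheses (c0 : 0 < c) (hausE : forall A, haus [set c *: x | x in A] = leb A).

Let cV : c^-1 * c = 1. Proof. by rewrite mulVf// gt_eqF. Qed.
Let cK : cancel (fun x : 'rV[R]_n => c *: x) (fun x => c^-1 *: x).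
Proof. by move=> x; rewrite scalerA cV scale1r. Qed.
Let cVK : cancel (fun x : 'rV[R]_n => c^-1 *: x) (fun x => c *: x).
Proof. by move=> x; rewrite scalerA divff ?scale1r// gt_eqF. Qed.

Let cU := [set c *: x | x in U].

Lemma scaled_measurable (A : set 'rV[R]_n) :
  haus.-caratheodory [set c *: x | x in A] <-> leb.-caratheodory A.
Proof. exact: (caratheodory_image (mu := leb) (nu := haus) _ cK cVK). Qed.

Let mcU : haus.-caratheodory cU. Proof. exact/scaled_measurable. Qed.

Let f' (x : 'rV[R]_n) : T' := h (c^-1 *: x).

Notation X := (graph_space mD f).
Notation Y := (graph_space mcU f').

Definition graph_over : set X := [set z : graph D f | U (\val z).1].

Lemma graph_preimage_over : graph_preimage (graph_over : set (graph D f)) = U.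
Proof.
apply/seteqP; split=> [x [Dx [z Uz zx]]|x Ux].
  by move: Uz; rewrite /graph_over/= (zx : \val z = _).
have gx : graph D f (x, f x) by exists x => //; exact: UD.
by split; [exact: UD|exists (SigSub (mem_set gx))].
Qed.

Lemma graph_point (z : graph D f) : (\val z).2 = f (\val z).1.
Proof. by case: z => z /= /set_mem[x _ <-]. Qed.

Lemma graph_point' (z : graph cU f') : (\val z).2 = f' (\val z).1.
Proof. by case: z => z /= /set_mem[x _ <-]. Qed.

Let base (u : graph_over) : 'rV[R]_n := (\val (\val u)).1.

Let base_in (u : graph_over) : U (base u).
Proof. exact: (set_mem (valP u)). Qed.

Let phi_subproof (u : graph_over) :
  (c *: base u, f' (c *: base u)) \in graph cU f'.
Proof. by apply/mem_set; exists (c *: base u) => //; exists (base u). Qed.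

(** The chart map: the dilation by c on base points, with the value of f
    replaced by the corresponding value of h. *)
Definition graph_scale (u : graph_over) : Y :=
  SigSub (phi_subproof u) : graph cU f'.

Let invbase (z : graph cU f') : 'rV[R]_n := c^-1 *: (\val z).1.

Let invbase_in z : U (invbase z).
Proof.
have [_ [x Ux <-] zE] := set_mem (valP z).
by rewrite /invbase -(zE : _ = \val z) /= cK.
Qed.

Let psi1_subproof (z : graph cU f') : (invbase z, f (invbase z)) \in graph D f.
Proof. by apply/mem_set; exists (invbase z) => //; apply/UD/invbase_in. Qed.

Let psi1 z : X := SigSub (psi1_subproof z) : graph D f.

Let psi_subproof z : psi1 z \in graph_over.
Proof. by apply/mem_set; exact: invbase_in. Qed.

Definition graph_unscale (z : Y) : graph_over := SigSub (psi_subproof z).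

Lemma graph_scaleK : cancel graph_scale graph_unscale.
Proof.
move=> u; apply: val_inj; apply: val_inj => /=; rewrite /invbase/= cK.
by have := graph_point (\val u); rewrite /base/=;
  case: (sval (sval u)) => x t /= ->.
Qed.

Lemma graph_unscaleK : cancel graph_unscale graph_scale.
Proof.
move=> z; apply: val_inj => /=; rewrite /base/= /invbase cVK.
by have /= := graph_point' z; case: (sval z) => x t /= ->.
Qed.

(** Along the projections to the base, the chart map is the dilation by c; the
    measure-theoretic conditions on it thus reduce to properties of c. *)
Lemma graph_preimage_scale (B : set (graph cU f')) :
  graph_preimage B =
  [set c *: x | x in
    graph_preimage (set_val @` (graph_scale @^-1` B) : set (graph D f))].
Proof.
apply/seteqP; split=> [y [_ [z Bz zy]]|_ [x [Dx [_ [u Bu <-] ux]] <-]].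
  exists (invbase z); last by rewrite /invbase (zy : \val z = _) /= cVK.
  split; first exact/UD/invbase_in.
  exists (psi1 z) => //; exists (graph_unscale z) => //=.
  by rewrite graph_unscaleK.
have bu : base u = x by rewrite /base (ux : \val (\val u) = _).
split; first by exists x => //; rewrite -bu; exact: base_in.
by exists (graph_scale u) => //; rewrite -bu.
Qed.

Lemma graph_scale_continuous : continuous graph_scale.
Proof.
have val_cont : continuous (fun u : graph_over => \val (\val u)).
  by move=> u; apply: continuous_comp; exact: initial_continuous.
have c1 : continuous (fun u : graph_over => c *: base u).
  move=> u; apply: (@continuous_comp _ _ _ base (fun x => c *: x)).
    by apply: (@continuous_comp _ _ _ _ fst); [exact: val_cont|exact: cvg_fst].
  exact: scaler_continuous.
have c2 : continuous (fun u : graph_over => f' (c *: base u) :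
  discrete_topology T').
  apply: (@factor_discrete_continuous graph_over T T'
    (fun u => (\val (\val u)).2)).
    move=> u; apply: (@continuous_comp _ _ _
      (fun u : graph_over => \val (\val u)) snd).
      exact: val_cont.
    exact: cvg_snd.
  move=> u v; rewrite !graph_point => uv; rewrite /f' !cK.
  by apply/fh => //; exact: base_in.
by apply: set_type_continuous => u; exact: (cvg_pair (c1 u) (c2 u)).
Qed.

Lemma graph_unscale_continuous : continuous graph_unscale.
Proof.
have val_cont : continuous (fun z : graph cU f' => \val z) by
  exact: initial_continuous.
have c1 : continuous invbase.
  move=> z; apply: (@continuous_comp _ _ _
    (fun z : graph cU f' => (\val z).1) (fun x => c^-1 *: x)).
    by apply: (@continuous_comp _ _ _ _ fst); [exact: val_cont|exact: cvg_fst].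
  exact: scaler_continuous.
have c2 : continuous (fun z : graph cU f' => f (invbase z) :
  discrete_topology T).
  apply: (@factor_discrete_continuous (graph cU f') T' T (fun z => (\val z).2)).
    move=> u; apply: (@continuous_comp _ _ _
      (fun z : graph cU f' => \val z) snd).
      exact: val_cont.
    exact: cvg_snd.
  by move=> u v; rewrite !graph_point' => uv; apply/fh => //; exact: invbase_in.
apply: set_type_continuous; apply: set_type_continuous => z.
exact: (cvg_pair (c1 z) (c2 z)).
Qed.

Lemma graph_scale_measure_preserving :
  measure_preserving_homeomorphism graph_scale.
Proof.
exists graph_unscale; split.
- exact: graph_scaleK.
- exact: graph_unscaleK.
- exact: graph_scale_continuous.
- exact: graph_unscale_continuous.
move=> B; rewrite /= /graph_sets /graph_measure /= graph_preimage_scale.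
by split; [exact: scaled_measurable|move=> _; rewrite hausE].
Qed.

Hypotheses (sh : sign_determined h) (hsurj : forall t, exists x, h x = t).

Lemma exists_graph_chart : exists C : chart X, chart_dom C = graph_over.
Proof.
have mover : ms_sets graph_over by
  rewrite /= /graph_sets /= graph_preimage_over.
have over0 : (0 < ms_measure graph_over)%E.
  by rewrite /= /graph_measure graph_preimage_over.
have llf : linear_logical cU f'.
  apply: sign_determined_linear_logical; first exact: sign_determined_scale.
  by move=> t; have [x xt] := hsurj t; exists (c *: x); rewrite /f' cK.
by exists (Chart mover over0 (ler0n R n) llf graph_scale_measure_preserving).
Qed.

End graph_chart.

(** * Approximation of measurable functions *)

Section approximation.
Context {R : realType} {n : nat}.
Notation leb := (@lebesgue_outer R n).

Lemma null_caratheodory T (mu : {outer_measure set T -> \bar R}) (A : set T) :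
  mu A = 0%E -> mu.-caratheodory A.
Proof.
move=> A0; apply: le_caratheodory_measurable => X.
have -> : mu (X `&` A) = 0%E.
  apply/eqP; rewrite eq_le outer_measure_ge0 andbT -A0.
  by apply: le_outer_measure; exact: subIsetr.
by rewrite add0e; apply: le_outer_measure; exact: subIsetl.
Qed.

Lemma continuous_affine_form (q : 'rV[R]_n * R) : continuous (affine_form q).
Proof.
move=> x; rewrite /affine_form.
apply: (@continuousD R _ _ (fun x : 'rV[R]_n => \sum_i x 0 i * q.1 0 i)
  (fun=> q.2)); last exact: cst_continuous.
apply: continuous_big => [|i _ z]; first exact: add_continuous.
exact: continuousM (@coord_continuous R 1 n 0 i z)
  (@cst_continuous _ _ (q.1 0 i) z).
Qed.

(** The fibres are finite unions of intersections of open and closed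
    half-spaces. *)
Lemma sign_determined_measurable (T : Type) (h : 'rV[R]_n -> T) (Y : set T) :
  sign_determined h -> leb.-caratheodory (h @^-1` Y).
Proof.
move=> [s hs].
pose sg x : {ffun 'I_(size s) -> bool} :=
  [ffun j => 0 <= affine_form (tnth (in_tuple s) j) x].
have sgh x y : sg x = sg y -> h x = h y.
  move=> xy; apply: hs => q /(tnthP (in_tuple s))[j ->].
  by have := congr1 (fun f : {ffun _ -> _} => f j) xy; rewrite !ffunE.
pose P := [set sigma | exists2 x, sg x = sigma & Y (h x)].
rewrite (_ : h @^-1` Y = \bigcup_(sigma in P) \bigcap_(j in [set: 'I_(size s)])
    [set x | (0 <= affine_form (tnth (in_tuple s) j) x) = sigma j]); last first.
  apply/seteqP; split=> [x Yx|x [_ [y <- Yy] xy]].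
    by exists (sg x); [exists x|move=> j _ /=; rewrite ffunE].
  rewrite /= (_ : h x = h y)//; apply: sgh; apply/ffunP => j.
  by have /= := xy j I; rewrite !ffunE => ->.
apply: (@fin_bigcup_measurable _ (caratheodory_type leb)) => [|sigma _].
  exact: finite_finset.
apply: (@fin_bigcap_measurable _ (caratheodory_type leb)) => [|j _].
  exact: finite_finset.
set q := tnth _ j.
have mq : leb.-caratheodory [set x | 0 <= affine_form q x].
  rewrite -[X in leb.-caratheodory X]setCK; apply: caratheodory_measurable_setC.
  apply: open_measurable_lebesgue_outer; apply: closed_openC.
  by apply: preimage_closed (@closed_ge _ 0) => x _;
    exact: continuous_affine_form.
case: (sigma j); first exact: mq.
rewrite (_ : [set x | _] = ~` [set x | 0 <= affine_form q x]).
  exact: caratheodory_measurable_setC.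
by apply/seteqP; split=> x /=; [move=> ->|move=> /negP/negbTE].
Qed.

Lemma sign_determined_boxes (T : finType)
    (S : T -> seq ('rV[R]_n * 'rV[R]_n)) (t0 : T) :
  sign_determined (fun x =>
    odflt t0 [pick t | `[< (\bigcup_(ab in [set` S t]) box ab) x >]]).
Proof.
pose corners := flatten [seq [seq ab.1 | ab <- S t] ++ [seq ab.2 | ab <- S t] |
  t : T].
pose form (c : 'rV[R]_n) (i : 'I_n) : 'rV[R]_n * R := (- delta_mx 0 i, c 0 i).
have formE c i x : affine_form (form c i) x = c 0 i - x 0 i.
  rewrite /affine_form (bigD1 i)//= big1 => [|j ji]; rewrite !mxE.
    by rewrite !eqxx addr0 mulrN1 addrC.
  by rewrite (negbTE ji) andbF oppr0 mulr0.
exists [seq form c i | c <- corners, i <- enum 'I_n] => x y xy.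
have corner c i : c \in corners -> (x 0 i <= c 0 i) = (y 0 i <= c 0 i).
  move=> cS; rewrite -[LHS]subr_ge0 -[RHS]subr_ge0 -!formE; apply: xy.
  by apply: allpairs_f => //; rewrite mem_enum.
have boxE t ab : ab \in S t -> box ab x <-> box ab y.
  move=> abS.
  have c1 : ab.1 \in corners.
    by apply/flatten_imageP; exists t => //; rewrite mem_cat map_f.
  have c2 : ab.2 \in corners.
    by apply/flatten_imageP; exists t => //; rewrite mem_cat (map_f snd) ?orbT.
  by split=> h i; have := h i; rewrite !ltNge !corner.
congr odflt; apply: eq_pick => t; apply: asbool_equiv_eq.
by split=> -[ab abS abx]; exists ab => //; apply/(boxE t).
Qed.

(** With V t a finite union of boxes close to the level set A t, let h x be
    some t with x in V t. If h x <> f x, then x misses V (f x) or lies in V t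
    for another t: in either case x is in some symmetric difference of A t and
    V t. *)
Lemma sign_determined_approximation (T : finType) (D : set 'rV[R]_n)
    (f : 'rV[R]_n -> T) (e : R) :
  (leb D < +oo)%E ->
  (forall Y : set T, leb.-caratheodory (D `&` f @^-1` Y)) -> 0 < e ->
  exists2 h : 'rV[R]_n -> T, sign_determined h &
    (leb (D `&` [set x | f x <> h x]) < e%:E)%E.
Proof.
move=> Doo mf e0.
pose A t := D `&` f @^-1` [set t].
pose d : R := e / (2 * #|T|.+1%:R).
have d0 : 0 < d by rewrite divr_gt0// mulr_gt0.
have /choice[S SP] : forall t, exists s : seq ('rV[R]_n * 'rV[R]_n),
    (leb (A t `\` \bigcup_(ab in [set` s]) box ab) <= d%:E)%E /\
    (leb (\bigcup_(ab in [set` s]) box ab `\` A t) <= d%:E)%E.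
  move=> t; apply: finite_box_approximation => //; first exact: mf.
  by apply: le_lt_trans Doo; apply: le_outer_measure; exact: subIsetl.
pose V t := \bigcup_(ab in [set` S t]) box ab.
exists (fun x => odflt (f 0) [pick t | `[< V t x >]]).
  exact: sign_determined_boxes.
set N := D `&` _.
pose E t := (A t `\` V t) `|` (V t `\` A t).
have NE : N `<=` \big[setU/set0]_t E t.
  move=> x [Dx /= fx].
  have [Vx|nVx] := pselect (V (f x) x); last first.
    by rewrite (bigD1 (f x))//=; left; left.
  move: fx; case: pickP => [t /asboolP Vt /= ft|/(_ (f x)) /asboolP//].
  by rewrite (bigD1 t)//=; left; right; split=> // -[_ /= /ft].
apply: le_lt_trans (le_outer_measure leb _ _ NE) _.
apply: le_lt_trans (outer_measure_bigsetU_le _ _ leb) _.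
apply: (@le_lt_trans _ _ (\sum_(t : T) (2 * d)%:E)%E).
  apply: lee_sum => t _; apply: le_trans (outer_measureU2 _ _ _) _.
  have [St1 St2] := SP t.
  by rewrite mulr2n mulrDl mul1r EFinD leeD.
have dE : d * (2 * #|T|.+1%:R) = e by rewrite divfK// mulf_neq0// pnatr_eq0.
rewrite -(natr1 #|T|) in dE.
rewrite sumEFin lte_fin sumr_const -[ltLHS]mulr_natr (@eq_card T _ T)//.
by rewrite (_ : 2 * d * _ = e - 2 * d) ?ltrBlDr ?ltrDl ?mulr_gt0// -dE; ring.
Qed.

End approximation.

(** * The logifold structure on the graph *)

Theorem corollary3p10 (R : realType) (n : nat) (D : set 'rV[R]_n)
    (mD : (@lebesgue_outer R n).-caratheodory D)
    (D_gt0 : (0 < lebesgue_outer D)%E) (D_fin : (lebesgue_outer D < +oo)%E)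
    (T : finType) (f : 'rV[R]_n -> T)
    (mf : forall Y : set T,
      (@lebesgue_outer R n).-caratheodory (D `&` f @^-1` Y))
    (eps : R) (eps_gt0 : 0 < eps) :
  exists (L : linear_logifold_structure (graph_space mD f))
    (i : logifold_index L), entire_up_to eps (logifold_chart i).
Proof.
pose leb := @lebesgue_outer R n.
have Df : leb D \is a fin_num by rewrite ge0_fin_numE ?outer_measure_ge0.
have [c c0 hausE] : exists2 c : R, 0 < c &
    forall A, hausdorff n%:R [set c *: x | x in A] = leb A.
  by apply: hausdorff_scaled_eq_lebesgue; exists D; rewrite D_gt0.
(* The minimum with the measure of D ensures that U has positive measure. *)
pose e := Num.min eps (fine (leb D)).
have e0 : 0 < e by rewrite lt_min eps_gt0 fine_gt0// D_gt0 D_fin.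
have [h0 sh0] := sign_determined_approximation D_fin mf e0.
set N := D `&` _ => Ne.
pose U := D `\` N.
have DU : D `\` U = N by rewrite setDD; apply/setIidr; exact: subIsetl.
have UE x : U x <-> D x /\ f x = h0 x.
  split=> [[Dx nN]|[Dx fx]]; last by split=> // -[_].
  by split=> //; apply: contrapT => fx; apply: nN.
have mU : leb.-caratheodory U.
  rewrite (_ : U = \bigcup_(t in [set: T])
      ((D `&` f @^-1` [set t]) `&` h0 @^-1` [set t])).
    apply: (@fin_bigcup_measurable _ (caratheodory_type leb)) => [|t _].
      exact: finite_finset.
    by apply: caratheodory_measurable_setI (mf _) _;
      exact: sign_determined_measurable.
  apply/seteqP; split=> [x /UE[Dx fx]|x [t _ [[Dx /= fx] /= hx]]].
    by exists (f x) => //; split.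
  by apply/UE; rewrite fx hx.
have U_gt0 : (0 < leb U)%E.
  rewrite lt0e outer_measure_ge0 andbT; apply/eqP => U0.
  have : (leb D <= leb U + leb N)%E.
    by rewrite -DU {1}[D](_ : D = U `|` D `\` U) ?outer_measureU2// setDUK//;
      exact: subDsetl.
  rewrite U0 add0e leNgt => /negP; apply; apply: lt_le_trans Ne _.
  by rewrite -(fineK Df) lee_fin ge_min lexx orbT.
have [C0 domC0] : exists C : chart (graph_space mD f),
    chart_dom C = graph_over U.
  (* Only the values of h0 become targets, to make the function surjective. *)
  pose T' := {t : T | `[< exists x, h0 x = t >]}.
  have h0P x : `[< exists y, h0 y = h0 x >] by apply/asboolP; exists x.
  pose h x : T' := Sub (h0 x) (h0P x).
  have hE x y : (h x = h y) <-> (h0 x = h0 y).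
    by split=> [/(congr1 val)//|xy]; apply: val_inj.
  apply: (@exists_graph_chart _ _ _ T' D mD f U h mU _ U_gt0 _ c c0 hausE).
  - exact: subDsetl.
  - by move=> x y /UE[_ ->] /UE[_ ->]; split=> /hE.
  - by have [s hs] := sh0; exists s => x y /hs xy; apply/hE.
  - move=> t; have /asboolP[x xt] := valP t.
    by exists x; apply: val_inj.
pose A t := D `&` f @^-1` [set t].
have level t : (0 < leb (A t))%E -> exists C : chart (graph_space mD f),
    chart_dom C = graph_over (A t).
  move=> At0.
  apply: (@exists_graph_chart _ _ _ unit D mD f (A t) (fun=> tt)
    (mf _) _ At0 _ c c0 hausE).
  - exact: subIsetl.
  - by move=> x y [_ /= ->] [_ /= ->].
  - by exists [::].
  - by move=> []; exists 0.
pose I := option {t : T | (0 < leb (A t))%E}.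
pose C (i : I) : chart (graph_space mD f) :=
  if i is Some t then projT1 (cid (level _ (svalP t))) else C0.
have CE t : chart_dom (C (Some t)) = graph_over (A (sval t)).
  exact: (projT2 (cid (level _ (svalP t)))).
pose rest := ~` \bigcup_i chart_dom (C i).
have rest0 : leb (graph_preimage (rest : set (graph D f))) = 0%E.
  apply/eqP; rewrite eq_le outer_measure_ge0 andbT.
  apply: (@le_trans _ _ (leb (\big[setU/set0]_(t | ~~ (0 < leb (A t))%E) A t))).
    apply: le_outer_measure => x [Dx [z nz zx]].
    rewrite (bigD1 (f x)) /=; first by left.
    apply/negP => Ax0; apply: nz; exists (Some (exist _ (f x) Ax0)) => //.
    by rewrite CE /graph_over/= (zx : \val z = _).
  apply: le_trans (outer_measure_bigsetU_le _ _ leb) _.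
  by rewrite big1// => t; rewrite lt0e outer_measure_ge0 andbT negbK => /eqP.
have mrest : ms_sets rest by exact: null_caratheodory.
exists (LinearLogifold (logifold_chart := C) mrest rest0), (None : I).
rewrite /entire_up_to /= domC0 /graph_measure -setTD graph_preimageC.
rewrite graph_preimage_over; last exact: subDsetl.
by rewrite DU; apply: lt_le_trans Ne _; rewrite lee_fin ge_min lexx.
Qed.
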